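(* Let $n,m_1,m_2$ be positive integers with $\gcd(m_1,m_2)=1$ and let $r\ge0$ be an integer. Let $$H=\langle x_1,\dots,x_r,a,b : a^{m_1}=b^{m_2},\ a^{m_1n}=1,\ [a^{m_1},x_i]=1\ \forall i=1,\dots,r\rangle.$$ Then, up to isomorphism, $H$ is the unique group $G$ such that (1) there exists a central extension $1\to\mathbb{Z}_n\to G\to\mathbb{F}_r*\mathbb{Z}_{m_1}*\mathbb{Z}_{m_2}\to1$, and (2) $G/G'\cong\mathbb{Z}_{nm_1m_2}\times\mathbb{Z}^r$, where $G'$ is the commutator subgroup. In particular $H\cong G((r+1)m_1;(r+1)m_2;nm_2)$, and if $\gcd(n,m_1m_2)=1$ then $H\cong\mathbb{Z}_n\times(\mathbb{F}_r*\mathbb{Z}_{m_1}*\mathbb{Z}_{m_2})$.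
   Context: $\mathbb{F}_r$ is the free group of rank $r$. Oka's group: for positive integers $p,q,r$, $G(p;q;r)=\langle \omega, a_i\ (i\in\mathbb{Z}) : \omega=a_{p-1}a_{p-2}\cdots a_0,\ \omega^r=e,\ a_i=a_{i+q}\ \forall i,\ a_{i+p}=\omega a_i\omega^{-1}\ \forall i\rangle$. *)

(* Defs.v *)
From Stdlib Require Import ZArith Arith.
From Stdlib Require Fin.


Record Grp := {
  carrier :> Type;
  gmul : carrier -> carrier -> carrier;
  gone : carrier;
  ginv : carrier -> carrier;
  gmulA : forall x y z, gmul x (gmul y z) = gmul (gmul x y) z;
  gmul1l : forall x, gmul gone x = x;
  gmul1r : forall x, gmul x gone = x;
  gmulVl : forall x, gmul (ginv x) x = gone;
  gmulVr : forall x, gmul x (ginv x) = gone }.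

Arguments gmul {g} _ _.
Arguments gone {g}.
Arguments ginv {g} _.

Definition is_hom {G K : Grp} (f : G -> K) : Prop :=
  forall x y, f (gmul x y) = gmul (f x) (f y).

Definition injective {A B : Type} (f : A -> B) := forall x y, f x = f y -> x = y.
Definition surjective {A B : Type} (f : A -> B) := forall y, exists x, f x = y.

Definition Iso (G K : Grp) : Prop :=
  exists f : G -> K, is_hom f /\ injective f /\ surjective f.

Definition prodGrp (G K : Grp) : Grp.
Proof.
  refine {| carrier := (G * K)%type;
            gmul := fun x y => (gmul (fst x) (fst y), gmul (snd x) (snd y));
            gone := (gone, gone);
            ginv := fun x => (ginv (fst x), ginv (snd x)) |}.
  - intros [] [] []; simpl; now rewrite !gmulA.
  - intros []; simpl; now rewrite !gmul1l.
  - intros []; simpl; now rewrite !gmul1r.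
  - intros []; simpl; now rewrite !gmulVl.
  - intros []; simpl; now rewrite !gmulVr.
Defined.

Inductive word (X : Type) : Type :=
| WVar : X -> word X
| WOne : word X
| WMul : word X -> word X -> word X
| WInv : word X -> word X.
Arguments WOne {X}.
Arguments WVar {X} _.
Arguments WMul {X} _ _.
Arguments WInv {X} _.

Fixpoint weval {X : Type} {G : Grp} (s : X -> G) (w : word X) : G :=
  match w with
  | WVar x => s x
  | WOne => gone
  | WMul u v => gmul (weval s u) (weval s v)
  | WInv u => ginv (weval s u)
  end.

Fixpoint wpow {X : Type} (w : word X) (k : nat) : word X :=
  match k with
  | 0 => WOne
  | S k => WMul w (wpow w k)
  end.

Definition wcomm {X : Type} (u v : word X) : word X :=
  WMul (WMul (WInv u) (WInv v)) (WMul u v).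

Definition is_presented {X : Type} (R : word X -> word X -> Prop)
  (G : Grp) (gen : X -> G) : Prop :=
  (forall u v, R u v -> weval gen u = weval gen v) /\
  (forall (K : Grp) (s : X -> K),
     (forall u v, R u v -> weval s u = weval s v) ->
     exists f : G -> K, is_hom f /\ (forall x, f (gen x) = s x) /\
       (forall g : G -> K, is_hom g -> (forall x, g (gen x) = s x) ->
          forall y, g y = f y)).

Inductive in_commutator {G : Grp} : G -> Prop :=
| ic_comm : forall x y : G,
    in_commutator (gmul (gmul (ginv x) (ginv y)) (gmul x y))
| ic_one : in_commutator gone
| ic_mul : forall x y, in_commutator x -> in_commutator y ->
    in_commutator (gmul x y)
| ic_inv : forall x, in_commutator x -> in_commutator (ginv x).

Inductive CycRel (k : nat) : word unit -> word unit -> Prop :=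
| cyc_rel : CycRel k (wpow (WVar tt) k) WOne.

(* Z_k x Z^r = < c, e_1..e_r | c^k = 1, all generators commute > *)
Inductive AbRel (k r : nat) : word (option (Fin.t r)) -> word (option (Fin.t r)) -> Prop :=
| ab_tor : AbRel k r (wpow (WVar None) k) WOne
| ab_comm : forall x y, AbRel k r (wcomm (WVar x) (WVar y)) WOne.

Inductive HGen (r : nat) : Type :=
| HX : Fin.t r -> HGen r
| HA : HGen r
| HB : HGen r.
Arguments HA {r}.
Arguments HX {r} _.
Arguments HB {r}.

(* free product F_r * Z_m1 * Z_m2 = < x_1..x_r, a, b | a^m1 = 1, b^m2 = 1 > *)
Inductive FPRel (m1 m2 r : nat) : word (HGen r) -> word (HGen r) -> Prop :=
| fp_a : FPRel m1 m2 r (wpow (WVar HA) m1) WOne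
| fp_b : FPRel m1 m2 r (wpow (WVar HB) m2) WOne.

Inductive HRel (n m1 m2 r : nat) : word (HGen r) -> word (HGen r) -> Prop :=
| h_ab : HRel n m1 m2 r (wpow (WVar HA) m1) (wpow (WVar HB) m2)
| h_ord : HRel n m1 m2 r (wpow (WVar HA) (m1 * n)) WOne
| h_comm : forall i, HRel n m1 m2 r (wcomm (wpow (WVar HA) m1) (WVar (HX i))) WOne.

Inductive OkaGen : Type :=
| OW : OkaGen
| OA : Z -> OkaGen.

Fixpoint okaprod (k : nat) : word OkaGen :=
  match k with
  | 0 => WOne
  | S k' => WMul (WVar (OA (Z.of_nat k'))) (okaprod k')
  end.

Inductive OkaRel (p q r : nat) : word OkaGen -> word OkaGen -> Prop :=
| oka_w : OkaRel p q r (WVar OW) (okaprod p)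
| oka_ord : OkaRel p q r (wpow (WVar OW) r) WOne
| oka_per : forall i : Z, OkaRel p q r (WVar (OA i)) (WVar (OA (i + Z.of_nat q)))
| oka_conj : forall i : Z, OkaRel p q r (WVar (OA (i + Z.of_nat p)))
                 (WMul (WMul (WVar OW) (WVar (OA i))) (WInv (WVar OW))).

Definition central_ext_cond (n m1 m2 r : nat) (G : Grp) : Prop :=
  exists (C : Grp) (cg : unit -> C) (F : Grp) (fg : HGen r -> F),
    is_presented (CycRel n) C cg /\ is_presented (FPRel m1 m2 r) F fg /\
    exists (iota : C -> G) (pi : G -> F),
      is_hom iota /\ injective iota /\
      (forall c (g : G), gmul (iota c) g = gmul g (iota c)) /\
      is_hom pi /\ surjective pi /\
      (forall g : G, pi g = gone <-> exists c, iota c = g).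

(* (2) G / G' is isomorphic to Z_k x Z^r: there is a surjective homomorphism
   onto Z_k x Z^r whose kernel is G' *)
Definition abelianization_cond (k r : nat) (G : Grp) : Prop :=
  exists (A : Grp) (ag : option (Fin.t r) -> A),
    is_presented (AbRel k r) A ag /\
    exists phi : G -> A, is_hom phi /\ surjective phi /\
      (forall g : G, phi g = gone <-> in_commutator g).

Definition HCond (n m1 m2 r : nat) (G : Grp) : Prop :=
  central_ext_cond n m1 m2 r G /\ abelianization_cond (n * m1 * m2) r G.

(* Main.v *)
(** Let [G] be a central extension of [F = F_r * Z_m1 * Z_m2] by [<t> = Z_n],
    with lifts satisfying [a^m1 = t^s] and [b^m2 = t^l].  Two words in the lifts
    that agree in [F] differ in [G] by an explicit power of [t], so [G] has the
    universal property of the corresponding presentation.  Hence, for each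
    [d] dividing [s], [m1] and [n], there are homomorphisms to [Z/d] separating
    [a] from [t], which is impossible for [d > 1] if the torsion of the
    abelianization is cyclic; likewise for [l] and [m2].  By the Chinese
    remainder theorem and a lift of a unit modulo [n], the lifts can then be
    multiplied by powers of [t] so that [a^m1 = b^m2 = t^w] with [w] prime to
    [n], and [G] is [H].

    For Oka's group write [R = r + 1] and choose [u m1 + v m2 = 1] with [v]
    prime to [n m2].  Then [a_(i+R) = W^u a_i W^(-u)], and with
    [D = a_r ... a_0] the relation [W = a_(p-1) ... a_0] telescopes to
    [(W^(-u) D)^m1 = W^(v m2)], where [W^m2] is central.  The isomorphism sends
    [x_i] to [a_i], [a] to [W^(-u) D] and [b] to [W^v]. *)

Require Import Defs.
From Stdlib Require Import ZArith Arith Znumtheory Lia.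
From Stdlib Require Import FunctionalExtensionality PropExtensionality.
From Stdlib Require Import ProofIrrelevance ClassicalEpsilon.
From Stdlib Require Fin.

Declare Scope grp_scope.
Delimit Scope grp_scope with grp.
Infix "*" := gmul : grp_scope.
Notation "1" := gone : grp_scope.
Local Open Scope grp_scope.

(** * Elementary group theory *)

Section Basics.
Context {G : Grp}.
Implicit Types x y z : G.

Lemma gmulKl x y : ginv x * (x * y) = y.
Proof. now rewrite gmulA, gmulVl, gmul1l. Qed.

Lemma gmulKr x y : x * (ginv x * y) = y.
Proof. now rewrite gmulA, gmulVr, gmul1l. Qed.

Lemma gmul_cancel_l x y z : x * y = x * z -> y = z.
Proof. intros h. now rewrite <- (gmulKl x y), h, gmulKl. Qed.

Lemma gmul_cancel_r x y z : y * x = z * x -> y = z.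
Proof.
  intros h. rewrite <- (gmul1r _ y), <- (gmul1r _ z), <- (gmulVr _ x), !gmulA.
  now rewrite h.
Qed.

Lemma ginv_unique x y : x * y = 1 -> ginv x = y.
Proof. intros h. apply (gmul_cancel_l x). now rewrite gmulVr, h. Qed.

Lemma ginvM x y : ginv (x * y) = ginv y * ginv x.
Proof.
  apply ginv_unique.
  now rewrite <- gmulA, (gmulA _ y), gmulVr, gmul1l, gmulVr.
Qed.

Lemma ginvK x : ginv (ginv x) = x.
Proof. apply ginv_unique, gmulVl. Qed.

Lemma ginv1 : ginv (gone : G) = 1.
Proof. apply ginv_unique, gmul1l. Qed.

Lemma gmulV_eq1 x y : ginv x * y = 1 <-> x = y.
Proof.
  split.
  - intros h. now rewrite <- (gmulKr x y), h, gmul1r.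
  - intros ->. apply gmulVl.
Qed.

End Basics.

Hint Rewrite <- @gmulA : grp.
Hint Rewrite @gmul1l @gmul1r @gmulVl @gmulVr @gmulKl @gmulKr
  @ginvM @ginvK @ginv1 : grp.
Ltac gsimpl := autorewrite with grp.

Definition commute {G : Grp} (x y : G) : Prop := x * y = y * x.

Definition central {G : Grp} (x : G) : Prop := forall y, commute x y.

Section Commute.
Context {G : Grp}.
Implicit Types x y z : G.

Lemma commute_sym x y : commute x y -> commute y x.
Proof. unfold commute; congruence. Qed.

Lemma commute_one x : commute x 1.
Proof. unfold commute; now gsimpl. Qed.

Lemma commute_mul x y z : commute x y -> commute x z -> commute x (y * z).
Proof.
  unfold commute; intros h1 h2.
  now rewrite gmulA, h1, <- gmulA, h2, gmulA.
Qed.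

Lemma commute_inv x y : commute x y -> commute x (ginv y).
Proof.
  unfold commute; intros h. apply (gmul_cancel_l y), (gmul_cancel_r y).
  gsimpl. now rewrite h.
Qed.

Lemma commute_weval {X} (s : X -> G) x w :
  (forall i, commute x (s i)) -> commute x (weval s w).
Proof.
  intros h; induction w; simpl;
    auto using commute_one, commute_mul, commute_inv.
Qed.

Lemma commutator_eq1 x y : ginv x * ginv y * (x * y) = 1 <-> commute x y.
Proof.
  unfold commute.
  replace (ginv x * ginv y) with (ginv (y * x)) by now gsimpl.
  rewrite gmulV_eq1. split; congruence.
Qed.

End Commute.

Fixpoint gnpow {G : Grp} (x : G) (k : nat) : G :=
  match k with
  | O => 1
  | S k => x * gnpow x k
  end.

Definition gpow {G : Grp} (x : G) (k : Z) : G :=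
  match k with
  | Z0 => 1
  | Zpos p => gnpow x (Pos.to_nat p)
  | Zneg p => ginv (gnpow x (Pos.to_nat p))
  end.
Arguments gpow {G} x%_grp_scope k%_Z_scope.
Infix "^" := gpow : grp_scope.

Section Powers.
Context {G : Grp}.
Implicit Types (x y : G) (a b k : Z).

Lemma gnpow_commute x (k : nat) : commute x (gnpow x k).
Proof.
  induction k; simpl; auto using commute_one.
  now apply commute_mul.
Qed.

Lemma gpow_nat x (k : nat) : x ^ Z.of_nat k = gnpow x k.
Proof. destruct k; simpl; auto. now rewrite SuccNat2Pos.id_succ. Qed.

Lemma gpow_0 x : x ^ 0 = 1.
Proof. reflexivity. Qed.

Lemma gpow_1 x : x ^ 1 = x.
Proof. simpl. now gsimpl. Qed.

Lemma gpow_id x a : a = 1%Z -> x ^ a = x.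
Proof. intros ->. apply gpow_1. Qed.

Lemma gpow_succ x k : x ^ (Z.succ k) = x * x ^ k.
Proof.
  destruct k as [|p|p].
  - simpl. reflexivity.
  - rewrite <- Pos2Z.inj_succ. simpl. now rewrite Pos2Nat.inj_succ.
  - destruct (Pos.succ_pred_or p) as [->|<-].
    + simpl. now gsimpl.
    + replace (Z.succ (Z.neg (Pos.succ (Pos.pred p))))
        with (Z.neg (Pos.pred p)) by lia.
      unfold gpow. rewrite Pos2Nat.inj_succ. simpl.
      rewrite (gnpow_commute x). now gsimpl.
Qed.

Lemma gpow_pred x k : x ^ (Z.pred k) = ginv x * x ^ k.
Proof.
  rewrite <- (Z.succ_pred k) at 2. rewrite gpow_succ. now gsimpl.
Qed.

Lemma gpow_add x a b : x ^ (a + b) = x ^ a * x ^ b.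
Proof.
  induction a using Z.peano_ind.
  - rewrite gpow_0, Z.add_0_l. now gsimpl.
  - rewrite Z.add_succ_l, !gpow_succ, IHa. now gsimpl.
  - rewrite Z.add_pred_l, !gpow_pred, IHa. now gsimpl.
Qed.

Lemma gpow_opp x a : x ^ (- a) = ginv (x ^ a).
Proof.
  symmetry; apply ginv_unique. now rewrite <- gpow_add, Z.add_opp_diag_r.
Qed.

Lemma gpow_mul x a b : (x ^ a) ^ b = x ^ (a * b).
Proof.
  induction b using Z.peano_ind.
  - now rewrite Z.mul_0_r.
  - rewrite gpow_succ, IHb, <- gpow_add. f_equal; lia.
  - rewrite gpow_pred, IHb, <- gpow_opp, <- gpow_add. f_equal; lia.
Qed.

Lemma gpow_one a : (gone : G) ^ a = 1.
Proof.
  induction a using Z.peano_ind; auto.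
  - now rewrite gpow_succ, IHa, gmul1l.
  - rewrite gpow_pred, IHa. now gsimpl.
Qed.

Lemma commute_pow x y a : commute x y -> commute x (y ^ a).
Proof.
  intros h; induction a using Z.peano_ind.
  - apply commute_one.
  - rewrite gpow_succ. now apply commute_mul.
  - rewrite gpow_pred. apply commute_mul; auto using commute_inv.
Qed.

Lemma commute_pow_pow x a b : commute (x ^ a) (x ^ b).
Proof. unfold commute. rewrite <- !gpow_add. f_equal; lia. Qed.

Lemma central_pow x a : central x -> central (x ^ a).
Proof. intros h y. apply commute_sym, commute_pow, commute_sym, h. Qed.

Lemma gpow_mul_commute x y a : commute x y -> (x * y) ^ a = x ^ a * y ^ a.
Proof.
  intros h.
  assert (hn : forall k : nat, gnpow (x * y) k = gnpow x k * gnpow y k).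
  { induction k; simpl; [now gsimpl|].
    assert (hy : commute y (gnpow x k)).
    { rewrite <- gpow_nat. now apply commute_pow, commute_sym. }
    rewrite IHk. gsimpl. now rewrite (gmulA _ y (gnpow x k)), hy, <- gmulA. }
  assert (hc : forall j k : nat, commute (gnpow x j) (gnpow y k)).
  { intros j k. rewrite <- !gpow_nat.
    now apply commute_pow, commute_sym, commute_pow, commute_sym. }
  destruct a as [|p|p]; simpl; [now gsimpl| |].
  - apply hn.
  - rewrite hn, hc. now gsimpl.
Qed.

Lemma gpow_congr x (n : Z) a b : x ^ n = 1 -> (n | a - b)%Z -> x ^ a = x ^ b.
Proof.
  intros h [c hc]. replace a with (n * c + b)%Z by lia.
  rewrite gpow_add, <- gpow_mul, h, gpow_one. now gsimpl.
Qed.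

Lemma weval_wpow {X} (s : X -> G) w (k : nat) :
  weval s (wpow w k) = weval s w ^ Z.of_nat k.
Proof. rewrite gpow_nat. induction k; simpl; congruence. Qed.

End Powers.

Section Homs.
Context {G K : Grp} {f : G -> K} (hf : is_hom f).

Lemma hom_one : f 1 = 1.
Proof.
  apply (gmul_cancel_l (f 1)). now rewrite <- hf, !gmul1r.
Qed.

Lemma hom_inv x : f (ginv x) = ginv (f x).
Proof. symmetry. apply ginv_unique. now rewrite <- hf, gmulVr, hom_one. Qed.

Lemma hom_pow x a : f (x ^ a) = f x ^ a.
Proof.
  induction a using Z.peano_ind.
  - apply hom_one.
  - rewrite !gpow_succ, hf. congruence.
  - rewrite !gpow_pred, hf, hom_inv. congruence.
Qed.

Lemma hom_weval {X} (s : X -> G) w : f (weval s w) = weval (fun i => f (s i)) w.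
Proof.
  induction w; simpl; rewrite ?hf, ?hom_inv, ?hom_one; congruence.
Qed.

Lemma hom_commutator :
  (forall x y : K, commute x y) -> forall x, in_commutator x -> f x = 1.
Proof.
  intros hK x hx. induction hx.
  - rewrite !hf, !hom_inv. apply commutator_eq1, hK.
  - apply hom_one.
  - rewrite hf, IHhx1, IHhx2. now gsimpl.
  - rewrite hom_inv, IHhx. now gsimpl.
Qed.

End Homs.

Lemma weval_ext {X} {G : Grp} (s s' : X -> G) w :
  (forall i, s i = s' i) -> weval s w = weval s' w.
Proof. intros h; induction w; simpl; congruence. Qed.

Lemma hom_comp {G K L : Grp} (g : K -> L) (f : G -> K) :
  is_hom g -> is_hom f -> is_hom (fun x => g (f x)).
Proof. intros hg hf x y. now rewrite hf, hg. Qed.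

Lemma Iso_of_inverse {G K : Grp} (f : G -> K) (g : K -> G) :
  is_hom f -> (forall x, g (f x) = x) -> (forall y, f (g y) = y) -> Iso G K.
Proof.
  intros hf h1 h2. exists f. split; [auto|split].
  - intros x y h. rewrite <- (h1 x), <- (h1 y). congruence.
  - intros y. now exists (g y).
Qed.

(** * Quotients and presentations *)

Section Quotient.
Context (T : Type) (mul : T -> T -> T) (one : T) (inv : T -> T)
  (E : T -> T -> Prop).

Record group_congruence : Prop := {
  gc_refl : forall x, E x x;
  gc_sym : forall x y, E x y -> E y x;
  gc_trans : forall x y z, E x y -> E y z -> E x z;
  gc_mul : forall x x' y y', E x x' -> E y y' -> E (mul x y) (mul x' y');
  gc_inv : forall x x', E x x' -> E (inv x) (inv x');
  gc_mulA : forall x y z, E (mul x (mul y z)) (mul (mul x y) z);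
  gc_mul1l : forall x, E (mul one x) x;
  gc_mul1r : forall x, E (mul x one) x;
  gc_mulVl : forall x, E (mul (inv x) x) one;
  gc_mulVr : forall x, E (mul x (inv x)) one }.

Context (hE : group_congruence).

(** An element is an equivalence class stored as a predicate; extensionality turns related
    representatives into equal elements. *)
Definition quot : Type := {P : T -> Prop | exists x, P = E x}.
Definition qcls (x : T) : quot := exist _ (E x) (ex_intro _ x eq_refl).

Lemma qcls_eq x y : qcls x = qcls y <-> E x y.
Proof.
  split.
  - intros h. apply (f_equal (@proj1_sig _ _)) in h. simpl in h.
    rewrite h. apply gc_refl, hE.
  - intros h. apply subset_eq_compat. apply functional_extensionality.
    intros z. apply propositional_extensionality. split; intros h'.
    + eapply gc_trans; eauto. now apply gc_sym.
    + eapply gc_trans; eauto.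
Qed.

Lemma quot_repr (q : quot) : {x : T | qcls x = q}.
Proof.
  apply constructive_indefinite_description.
  destruct q as [P [x ->]]. now exists x.
Qed.

Definition qrep (q : quot) : T := proj1_sig (quot_repr q).

Lemma qrepK q : qcls (qrep q) = q.
Proof. exact (proj2_sig (quot_repr q)). Qed.

Lemma qrep_cls x : E (qrep (qcls x)) x.
Proof. apply qcls_eq, qrepK. Qed.

Definition qmul (p q : quot) : quot := qcls (mul (qrep p) (qrep q)).
Definition qinv (p : quot) : quot := qcls (inv (qrep p)).

Lemma qmul_cls x y : qmul (qcls x) (qcls y) = qcls (mul x y).
Proof. apply qcls_eq, gc_mul; auto using qrep_cls. Qed.

Lemma qinv_cls x : qinv (qcls x) = qcls (inv x).
Proof. apply qcls_eq, gc_inv; auto using qrep_cls. Qed.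

Definition quotGrp : Grp.
Proof.
  refine {| carrier := quot; gmul := qmul; gone := qcls one; ginv := qinv |}.
  - intros x y z. rewrite <- (qrepK x), <- (qrepK y), <- (qrepK z), !qmul_cls.
    apply qcls_eq, gc_mulA, hE.
  - intros x. rewrite <- (qrepK x), qmul_cls. apply qcls_eq, gc_mul1l, hE.
  - intros x. rewrite <- (qrepK x), qmul_cls. apply qcls_eq, gc_mul1r, hE.
  - intros x. rewrite <- (qrepK x), qinv_cls, qmul_cls.
    apply qcls_eq, gc_mulVl, hE.
  - intros x. rewrite <- (qrepK x), qinv_cls, qmul_cls.
    apply qcls_eq, gc_mulVr, hE.
Defined.

End Quotient.

Arguments qcls {T E} x.

(** * The group defined by a presentation *)

Section WordGroup.
Context {X : Type} (R : word X -> word X -> Prop).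

(** The least congruence containing [R] and the group axioms. Being inductive, it allows induction
    over the derivations of an equality between words. *)
Inductive cong : word X -> word X -> Prop :=
| cong_rel u v : R u v -> cong u v
| cong_refl u : cong u u
| cong_sym u v : cong u v -> cong v u
| cong_trans u v w : cong u v -> cong v w -> cong u w
| cong_mul u u' v v' : cong u u' -> cong v v' -> cong (WMul u v) (WMul u' v')
| cong_inv u u' : cong u u' -> cong (WInv u) (WInv u')
| cong_mulA u v w : cong (WMul u (WMul v w)) (WMul (WMul u v) w)
| cong_mul1l u : cong (WMul WOne u) u
| cong_mul1r u : cong (WMul u WOne) u
| cong_mulVl u : cong (WMul (WInv u) u) WOne
| cong_mulVr u : cong (WMul u (WInv u)) WOne.

Lemma cong_group_congruence : group_congruence _ WMul WOne WInv cong.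
Proof. split; eauto using cong. Qed.

Definition wordGrp : Grp := quotGrp _ _ _ _ _ cong_group_congruence.
Definition wordgen (x : X) : wordGrp := qcls (WVar x).

Lemma weval_wordgen w : weval wordgen w = qcls w :> wordGrp.
Proof.
  pose proof cong_group_congruence as h.
  induction w; simpl; auto.
  - rewrite IHw1, IHw2. exact (qmul_cls _ _ _ _ _ h _ _).
  - rewrite IHw. exact (qinv_cls _ _ _ _ _ h _).
Qed.

Lemma weval_cong {K : Grp} (s : X -> K) :
  (forall u v, R u v -> weval s u = weval s v) ->
  forall u v, cong u v -> weval s u = weval s v.
Proof.
  intros hs u v h; induction h; simpl; gsimpl; try congruence. now apply hs.
Qed.

(** Evaluating a chosen representative is well defined by [weval_cong]; uniqueness holds because
    every class is the value of a word in the generators. *)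
Lemma wordGrp_presented : is_presented R wordGrp wordgen.
Proof.
  pose proof cong_group_congruence as h.
  split.
  - intros u v huv. rewrite !weval_wordgen. apply (qcls_eq _ _ _ _ _ h).
    now apply cong_rel.
  - intros K s hs.
    exists (fun q : wordGrp => weval s (qrep _ _ q)).
    assert (hw : forall w, weval s (qrep _ _ (@qcls _ cong w)) = weval s w).
    { intros w. apply weval_cong; auto. apply (qrep_cls _ _ _ _ _ h). }
    split; [|split].
    + intros x y. exact (hw (WMul (qrep _ _ x) (qrep _ _ y))).
    + intros x. exact (hw (WVar x)).
    + intros g hg hgs y. rewrite <- (qrepK _ _ y) at 1.
      rewrite <- weval_wordgen, (hom_weval hg). now apply weval_ext.
Qed.

End WordGroup.

Section Presented.
Context {X : Type} {R : word X -> word X -> Prop} {G : Grp} {gen : X -> G}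
  (hG : is_presented R G gen).

Lemma presented_hom (K : Grp) (s : X -> K) :
  (forall u v, R u v -> weval s u = weval s v) ->
  exists f : G -> K, is_hom f /\ forall x, f (gen x) = s x.
Proof.
  intros hs. destruct (proj2 hG K s hs) as (f & hf & hfs & _). now exists f.
Qed.

(** By uniqueness in the universal property, the round trip through the word group is the identity,
    so a representative of the image of [y] there evaluates to [y]. *)
Lemma presented_word y : exists w, weval gen w = y.
Proof.
  destruct (wordGrp_presented R) as [hR hK].
  destruct (presented_hom _ _ hR) as (f & hf & hfs).
  destruct (hK G gen (proj1 hG)) as (g & hg & hgs & _).
  destruct (proj2 hG G gen (proj1 hG)) as (i & _ & _ & hu).
  exists (qrep _ _ (f y)).
  assert (hgf : g (f y) = y).
  { rewrite (hu (fun z => g (f z))); [rewrite (hu (fun z => z)); auto| |].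
    - intros a b; auto.
    - apply (hom_comp g f hg hf).
    - intros x. now rewrite hfs, hgs. }
  rewrite <- hgf at 2. rewrite <- (qrepK _ _ (f y)) at 2.
  rewrite <- weval_wordgen, (hom_weval hg). apply weval_ext. auto.
Qed.

(** Mapping [G] to the word group turns an equality of values into a derivation from the relations,
    open to induction. *)
Lemma presented_cong u v : weval gen u = weval gen v -> cong R u v.
Proof.
  intros h. destruct (wordGrp_presented R) as [hR _].
  destruct (presented_hom _ _ hR) as (f & hf & hfs).
  apply (f_equal f) in h. rewrite !(hom_weval hf) in h.
  rewrite !(weval_ext (fun i => f (gen i)) (wordgen R)), !weval_wordgen in h
    by auto.
  now apply (qcls_eq _ _ _ _ _ (cong_group_congruence R)) in h.
Qed.

Lemma presented_hom_eq {K : Grp} (f g : G -> K) :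
  is_hom f -> is_hom g -> (forall x, f (gen x) = g (gen x)) ->
  forall y, f y = g y.
Proof.
  intros hf hg h y. destruct (presented_word y) as [w <-].
  rewrite (hom_weval hf), (hom_weval hg). now apply weval_ext.
Qed.

Lemma presented_central x : (forall i, commute x (gen i)) -> central x.
Proof.
  intros h y. destruct (presented_word y) as [w <-]. now apply commute_weval.
Qed.

End Presented.

(** * The integers modulo [d] *)

Section Zmod.
Context (d : Z).

Lemma Zmod_congruence :
  group_congruence Z Z.add 0%Z Z.opp (fun x y => (d | x - y)%Z).
Proof.
  split; intros.
  - exists 0%Z; lia.
  - destruct H as [c hc]. exists (- c)%Z; lia.
  - destruct H as [c hc], H0 as [c' hc']. exists (c + c')%Z; lia.
  - destruct H as [c hc], H0 as [c' hc']. exists (c + c')%Z; lia.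
  - destruct H as [c hc]. exists (- c)%Z; lia.
  - exists 0%Z; lia.
  - exists 0%Z; lia.
  - exists 0%Z; lia.
  - exists 0%Z; lia.
  - exists 0%Z; lia.
Qed.

(** For [d = 0] the relation is equality, so [Zmod 0] is the infinite cyclic group. *)
Definition Zmod : Grp := quotGrp _ _ _ _ _ Zmod_congruence.
Definition zcls (x : Z) : Zmod := qcls x.

Lemma zcls_eq x y : zcls x = zcls y <-> (d | x - y)%Z.
Proof. exact (qcls_eq _ _ _ _ _ Zmod_congruence x y). Qed.

Lemma zcls_mul x y : zcls x * zcls y = zcls (x + y).
Proof. exact (qmul_cls _ _ _ _ _ Zmod_congruence x y). Qed.

Lemma zcls_inv x : ginv (zcls x) = zcls (- x).
Proof. exact (qinv_cls _ _ _ _ _ Zmod_congruence x). Qed.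

Lemma zcls_surj y : exists x, y = zcls x.
Proof. destruct y as [P [x ->]]. now exists x. Qed.

Lemma zcls_pow x k : zcls x ^ k = zcls (x * k).
Proof.
  induction k using Z.peano_ind.
  - now rewrite Z.mul_0_r.
  - rewrite gpow_succ, IHk, zcls_mul. f_equal; lia.
  - rewrite gpow_pred, IHk, zcls_inv, zcls_mul. f_equal; lia.
Qed.

Lemma Zmod_comm (x y : Zmod) : commute x y.
Proof.
  destruct (zcls_surj x) as [a ->], (zcls_surj y) as [b ->].
  unfold commute. rewrite !zcls_mul. f_equal; lia.
Qed.

End Zmod.

(** * Lifting units modulo n *)

Local Open Scope Z_scope.

(** Divide [n] by its gcd with [w] repeatedly until the rest [k] is prime to [w]; each removed
    factor divides [w], so their product divides a power of [w]. *)
Lemma coprime_part (w n : Z) : 0 < n ->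
  exists k (N : nat), rel_prime k w /\ (n | w ^ Z.of_nat N * k).
Proof.
  intros hn. assert (h0 : 0 <= n) by lia. revert n h0 hn.
  apply (Z_lt_induction (fun n => 0 < n -> exists k (N : nat),
    rel_prime k w /\ (n | w ^ Z.of_nat N * k))).
  intros n IH hn.
  pose proof (Z.gcd_nonneg n w) as hg.
  destruct (Z.gcd_divide_l n w) as [n1 hn1], (Z.gcd_divide_r n w) as [w1 hw1].
  pose proof (Zgcd_1_rel_prime n w) as hrel.
  set (e := Z.gcd n w) in *. clearbody e.
  destruct (Z.eq_dec e 1) as [he|he].
  - exists n, 0%nat. split.
    + now apply hrel.
    + exists 1. simpl. lia.
  - assert (e <> 0) by (intros ->; lia). assert (0 < n1) by nia. assert (n1 < n) by nia.
    destruct (IH n1) as (k & N & hk & c & hc); [lia|lia|].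
    exists k, (S N). split; [auto|]. exists (w1 * c).
    rewrite Nat2Z.inj_succ, Z.pow_succ_r by lia.
    rewrite hn1, <- (Z.mul_assoc w), hc. lia.
Qed.

Lemma rel_prime_intro (a b : Z) :
  (forall d, (d | a) -> (d | b) -> (d | 1)) -> rel_prime a b.
Proof.
  intros h. split; auto using Z.divide_1_l.
Qed.

Lemma rel_prime_divide_1 (a b d : Z) :
  rel_prime a b -> (d | a) -> (d | b) -> (d | 1).
Proof. intros [_ _ h]. apply h. Qed.

(** Take for [k] the part of [n] prime to [w]. A common divisor of [w + k * g] and [n] is then prime
    to [k] and, by the hypothesis, to [w]; yet it divides [w ^ N * k]. *)
Lemma unit_lift (w g n : Z) : 0 < n ->
  (forall d, (d | w) -> (d | g) -> (d | n) -> (d | 1)) ->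
  exists k, rel_prime (w + k * g) n.
Proof.
  intros hn h. destruct (coprime_part w n hn) as (k & N & hk & hkn).
  exists k. apply rel_prime_intro. intros d hd1 hd2.
  assert (hdk : rel_prime d k).
  { apply rel_prime_intro. intros f hf1 hf2.
    apply (rel_prime_divide_1 _ _ _ hk hf2).
    apply (Z.divide_add_cancel_r _ (k * g) w).
    - now apply Z.divide_mul_l.
    - rewrite Z.add_comm. now apply Z.divide_trans with d. }
  assert (hdw : rel_prime d w).
  { apply rel_prime_intro. intros f hf1 hf2. apply h; auto.
    - apply Gauss with k.
      + apply (Z.divide_add_cancel_r _ w (k * g)); auto.
        now apply Z.divide_trans with d.
      + apply rel_prime_sym, rel_prime_sym. apply rel_prime_div with d; auto.
    - now apply Z.divide_trans with d. }
  assert (hdN : (d | w ^ Z.of_nat N)).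
  { apply Gauss with k; auto. rewrite Z.mul_comm.
    now apply Z.divide_trans with n. }
  apply (rel_prime_divide_1 d (w ^ Z.of_nat N)); auto using Z.divide_refl.
  clear - hdw. induction N.
  - apply rel_prime_sym, rel_prime_1.
  - rewrite Nat2Z.inj_succ, Z.pow_succ_r by lia. now apply rel_prime_mult.
Qed.

(** Adding multiples of [m1 * m2] to a Chinese remainder solution [w0] keeps both congruences.
    [unit_lift] applies: a common divisor of [w0], [m1 * m2] and [n] is prime to [m1] by the
    condition on [s] and to [m2] by the one on [l]. *)
Lemma common_unit (m1 m2 n s l : Z) : 0 < n -> rel_prime m1 m2 ->
  (forall d, (d | s) -> (d | m1) -> (d | n) -> (d | 1)) ->
  (forall d, (d | l) -> (d | m2) -> (d | n) -> (d | 1)) ->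
  exists w j k, w = s + m1 * j /\ w = l + m2 * k /\ rel_prime w n.
Proof.
  intros hn hm hs hl.
  destruct (rel_prime_bezout _ _ hm) as [u v huv].
  set (w0 := s + m1 * (u * (l - s))).
  assert (hw0 : w0 = l + m2 * (v * (s - l))).
  { assert ((s - l) * (u * m1 + v * m2) = s - l) by (rewrite huv; lia).
    unfold w0. lia. }
  destruct (unit_lift w0 (m1 * m2) n hn) as [k hk].
  { intros d hd1 hd2 hd3.
    assert (h1 : rel_prime d m1).
    { apply rel_prime_intro. intros f hf1 hf2.
      apply hs; auto; [|now apply Z.divide_trans with d].
      apply (Z.divide_add_cancel_r _ (m1 * (u * (l - s)))).
      - now apply Z.divide_mul_l.
      - rewrite Z.add_comm. now apply Z.divide_trans with d. }
    assert (h2 : rel_prime d m2).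
    { apply rel_prime_intro. intros f hf1 hf2.
      apply hl; auto; [|now apply Z.divide_trans with d].
      apply (Z.divide_add_cancel_r _ (m2 * (v * (s - l)))).
      - now apply Z.divide_mul_l.
      - rewrite Z.add_comm, <- hw0. now apply Z.divide_trans with d. }
    apply (rel_prime_divide_1 d (m1 * m2)); auto using Z.divide_refl.
    now apply rel_prime_mult. }
  exists (w0 + k * (m1 * m2)), (u * (l - s) + k * m2), (v * (s - l) + k * m1).
  split; [unfold w0; lia|]. split; [rewrite hw0; lia|auto].
Qed.

Lemma rel_prime_inverse (w n : Z) : rel_prime w n -> exists v, (n | w * v - 1).
Proof.
  intros h. destruct (rel_prime_bezout _ _ h) as [v c hv].
  exists v, (- c). lia.
Qed.

Lemma nat_gcd_rel_prime (a b : nat) :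
  Nat.gcd a b = 1%nat -> rel_prime (Z.of_nat a) (Z.of_nat b).
Proof.
  intros h. pose proof (Nat.gcd_bezout a b) as hb. rewrite h in hb.
  apply bezout_rel_prime.
  destruct hb as [(u & v & huv)|(u & v & huv)].
  - apply Bezout_intro with (Z.of_nat u) (- Z.of_nat v)%Z. lia.
  - apply Bezout_intro with (- Z.of_nat v)%Z (Z.of_nat u). lia.
Qed.

Local Close Scope Z_scope.

(** * Central extensions of the free product by a cyclic group *)

Lemma fst_hom (G K : Grp) : is_hom (fun x : prodGrp G K => fst x).
Proof. intros x y. reflexivity. Qed.

Lemma snd_hom (G K : Grp) : is_hom (fun x : prodGrp G K => snd x).
Proof. intros x y. reflexivity. Qed.

Lemma prod_pow {G K : Grp} (x : prodGrp G K) k :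
  x ^ k = (fst x ^ k, snd x ^ k).
Proof.
  rewrite (surjective_pairing (x ^ k)). f_equal.
  - apply (hom_pow (fst_hom G K)).
  - apply (hom_pow (snd_hom G K)).
Qed.

Lemma prod_weval {X} {G K : Grp} (s : X -> G) (s' : X -> K) w :
  weval (fun x => (s x, s' x) : prodGrp G K) w = (weval s w, weval s' w).
Proof. induction w; simpl; rewrite ?IHw1, ?IHw2, ?IHw; reflexivity. Qed.

(** Induction on the derivation: a defining relation costs a factor [t ^ s] or [t ^ l], and
    centrality collects all such factors on the right. *)
Lemma FP_cong_shift (m1 m2 r : nat) (G : Grp) (gen : HGen r -> G) (t : G) (s l : Z) :
  central t -> gen HA ^ Z.of_nat m1 = t ^ s -> gen HB ^ Z.of_nat m2 = t ^ l ->
  forall u v, cong (FPRel m1 m2 r) u v ->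
  exists k, weval gen u = weval gen v * t ^ k.
Proof.
  intros ht ha hb.
  assert (htp : forall k x, t ^ k * x = x * t ^ k).
  { intros k x. now apply central_pow. }
  intros u v h; induction h; simpl.
  - destruct H; rewrite weval_wpow; simpl; [exists s|exists l];
      rewrite ?ha, ?hb; now gsimpl.
  - exists 0%Z. rewrite gpow_0. now gsimpl.
  - destruct IHh as [k ->]. exists (- k)%Z. rewrite gpow_opp. now gsimpl.
  - destruct IHh1 as [k ->], IHh2 as [k' ->]. exists (k' + k)%Z.
    rewrite gpow_add. now gsimpl.
  - destruct IHh1 as [k ->], IHh2 as [k' ->]. exists (k + k')%Z.
    rewrite gpow_add. gsimpl. f_equal. now rewrite gmulA, htp, <- gmulA.
  - destruct IHh as [k ->]. exists (- k)%Z.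
    gsimpl. now rewrite <- gpow_opp, htp.
  - exists 0%Z. rewrite gpow_0. now gsimpl.
  - exists 0%Z. rewrite gpow_0. now gsimpl.
  - exists 0%Z. rewrite gpow_0. now gsimpl.
  - exists 0%Z. rewrite gpow_0. now gsimpl.
  - exists 0%Z. rewrite gpow_0. now gsimpl.
Qed.

(** * Extensions with chosen lifts and their universal property *)

Section CentralExtension.
Context {n m1 m2 r : nat} {F : Grp} {fg : HGen r -> F}
  (hF : is_presented (FPRel m1 m2 r) F fg).

(** [t] generates the kernel and has order [n], and [gen] lifts the generators of [F], so
    surjectivity of [pi] is implied. The exponents [s] and [l] matter only modulo [n]. *)
Record lifted_extension (G : Grp) (t : G) (pi : G -> F) (gen : HGen r -> G)
    (s l : Z) : Prop := {
  le_central : central t;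
  le_order : forall i, t ^ i = 1 <-> (Z.of_nat n | i)%Z;
  le_hom : is_hom pi;
  le_pi_t : pi t = 1;
  le_ker : forall g, pi g = 1 -> exists i, g = t ^ i;
  le_gen : forall x, pi (gen x) = fg x;
  le_a : gen HA ^ Z.of_nat m1 = t ^ s;
  le_b : gen HB ^ Z.of_nat m2 = t ^ l }.

Context {G : Grp} {t : G} {pi : G -> F} {gen : HGen r -> G} {s l : Z}
  (hG : lifted_extension G t pi gen s l).

Lemma lifted_word g : exists w i, g = weval gen w * t ^ i.
Proof.
  destruct (presented_word hF (pi g)) as [w hw].
  destruct (le_ker _ _ _ _ _ _ hG (ginv (weval gen w) * g)) as [i hi].
  - rewrite (le_hom _ _ _ _ _ _ hG), (hom_inv (le_hom _ _ _ _ _ _ hG)).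
    rewrite (hom_weval (le_hom _ _ _ _ _ _ hG)).
    rewrite (weval_ext _ fg) by apply (le_gen _ _ _ _ _ _ hG).
    rewrite hw. apply gmulVl.
  - exists w, i. rewrite <- hi. now gsimpl.
Qed.

(** [G] behaves as if presented by [gen] and [t] with [t] central, [t^n = 1], [a^m1 = t^s],
    [b^m2 = t^l]. The map is read off its graph [R], which is total by [lifted_word]; the point is
    that it is single-valued. *)
Lemma lifted_hom (K : Grp) (chi : HGen r -> K) (tau : K) :
  central tau -> tau ^ Z.of_nat n = 1 ->
  chi HA ^ Z.of_nat m1 = tau ^ s -> chi HB ^ Z.of_nat m2 = tau ^ l ->
  exists h : G -> K, is_hom h /\ (forall x, h (gen x) = chi x) /\ h t = tau.
Proof.
  intros htau hn ha hb.
  set (R := fun (g : G) (y : K) => exists w i,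
    g = weval gen w * t ^ i /\ y = weval chi w * tau ^ i).
  assert (tc : forall k x, t ^ k * x = x * t ^ k).
  { intros k x. apply central_pow, (le_central _ _ _ _ _ _ hG). }
  assert (tauc : forall k x, tau ^ k * x = x * tau ^ k).
  { intros k x. now apply central_pow. }
  assert (htot : forall g, exists y, R g y).
  { intros g. destruct (lifted_word g) as (w & i & hg).
    now exists (weval chi w * tau ^ i), w, i. }
  (* Applying the shift lemma in [G * K] to the central element [(t, tau)]
     makes the exponents of [t] and [tau] agree. *)
  assert (h1 : forall y, R 1 y -> y = 1).
  { intros y (w & i & hw & ->).
    set (M := prodGrp G K).
    set (gm := fun x => (gen x, chi x) : M).
    set (T := (t, tau) : M).
    assert (hp : forall (x : M) k, x ^ k = (fst x ^ k, snd x ^ k) :> M)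
      by (intros; apply prod_pow).
    assert (hev : forall v, weval gm v = (weval gen v, weval chi v) :> M)
      by (intros; apply prod_weval).
    (* A word whose value in [G] is a power of [t] is trivial in [F], hence derivably trivial from
       the relations of [F]. *)
    assert (hwF : weval fg w = weval fg WOne).
    { apply (f_equal pi) in hw. pose proof (le_hom _ _ _ _ _ _ hG) as hpi.
      rewrite hpi, (hom_one hpi), (hom_pow hpi), (le_pi_t _ _ _ _ _ _ hG) in hw.
      rewrite gpow_one, gmul1r, (hom_weval hpi) in hw. simpl. rewrite hw.
      apply weval_ext. intros x. symmetry. apply (le_gen _ _ _ _ _ _ hG). }
    apply (presented_cong hF) in hwF.
    destruct (FP_cong_shift m1 m2 r M gm T s l) with (u := w) (v := @WOne (HGen r))
      as [k hk]; auto.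
    - intros [x y]. unfold commute; simpl. f_equal.
      + apply (le_central _ _ _ _ _ _ hG).
      + apply htau.
    - rewrite !hp. simpl. f_equal; auto. apply (le_a _ _ _ _ _ _ hG).
    - rewrite !hp. simpl. f_equal; auto. apply (le_b _ _ _ _ _ _ hG).
    - rewrite hev, hp in hk. simpl in hk. rewrite !gmul1l in hk.
      injection hk as hk1 hk2. rewrite hk1, <- gpow_add in hw.
      (* Now [t ^ (k + i) = 1], so [n] divides [k + i], which kills [tau ^ (k + i)]. *)
      rewrite hk2, <- gpow_add. symmetry in hw.
      apply (le_order _ _ _ _ _ _ hG) in hw. rewrite <- (gpow_0 tau).
      apply gpow_congr with (Z.of_nat n); auto.
      now rewrite Z.sub_0_r. }
  assert (hR1 : R 1 1).
  { exists WOne, 0%Z. rewrite !gpow_0. simpl. now gsimpl. }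
  assert (hRM : forall g g' y y', R g y -> R g' y' -> R (g * g') (y * y')).
  { intros g g' y y' (w & i & -> & ->) (w' & i' & -> & ->).
    exists (WMul w w'), (i + i')%Z. rewrite !gpow_add. simpl. gsimpl.
    split; f_equal; rewrite !gmulA; f_equal; auto. }
  assert (hRV : forall g y, R g y -> R (ginv g) (ginv y)).
  { intros g y (w & i & -> & ->). exists (WInv w), (- i)%Z.
    rewrite !gpow_opp. simpl. gsimpl. rewrite <- !gpow_opp. auto. }
  (* [R] is a subgroup of the product of [G] and [K], so two values over the same [g] differ by a
     value over the identity. *)
  assert (huniq : forall g y y', R g y -> R g y' -> y = y').
  { intros g y y' hy hy'. symmetry. apply gmulV_eq1. apply h1.
    rewrite <- (gmulVl _ g). auto. }
  set (h := fun g => proj1_sig (constructive_indefinite_description _ (htot g))).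
  assert (hh : forall g, R g (h g)).
  { intros g. exact (proj2_sig (constructive_indefinite_description _ (htot g))). }
  exists h. split; [|split].
  - intros x y. apply (huniq (x * y)); auto.
  - intros x. apply (huniq (gen x)); auto.
    exists (WVar x), 0%Z. rewrite !gpow_0. simpl. now gsimpl.
  - apply (huniq t); auto.
    exists WOne, 1%Z. rewrite !gpow_1. simpl. now gsimpl.
Qed.

(** Multiplying the lifts of [a] and [b] by [t ^ j] and [t ^ k] does not change their
    projections. *)
Lemma lifted_modify (j k : Z) :
  exists gen',
    lifted_extension G t pi gen' (s + Z.of_nat m1 * j) (l + Z.of_nat m2 * k).
Proof.
  exists (fun x => match x with
    | HX i => gen (HX i) | HA => gen HA * t ^ j | HB => gen HB * t ^ k end).
  destruct hG as [h1 h2 h3 h4 h5 h6 h7 h8]. split; auto.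
  - intros [i| |]; rewrite ?h3, ?(hom_pow h3), ?h4, ?gpow_one, ?gmul1r; auto.
  - rewrite gpow_mul_commute by (apply commute_pow, commute_sym, h1).
    rewrite h7, gpow_mul, <- gpow_add. f_equal; lia.
  - rewrite gpow_mul_commute by (apply commute_pow, commute_sym, h1).
    rewrite h8, gpow_mul, <- gpow_add. f_equal; lia.
Qed.

End CentralExtension.
(** * The groups presented in the statement *)

Section Cyclic.
Context {n : nat} {C : Grp} {cg : unit -> C} (hC : is_presented (CycRel n) C cg).

Lemma Cyc_rel : cg tt ^ Z.of_nat n = 1.
Proof.
  pose proof (proj1 hC _ _ (cyc_rel n)) as h. now rewrite weval_wpow in h.
Qed.

Lemma Cyc_hom (K : Grp) (x : K) : x ^ Z.of_nat n = 1 ->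
  exists f : C -> K, is_hom f /\ f (cg tt) = x.
Proof.
  intros hx. destruct (presented_hom hC K (fun _ => x)) as (f & hf & hfx).
  - intros u v []. now rewrite weval_wpow.
  - now exists f.
Qed.

Lemma Cyc_pow y : exists i, y = cg tt ^ i.
Proof.
  destruct (presented_word hC y) as [w <-].
  induction w as [[]| |u [i hi] v [j hj]|u [i hi]]; simpl.
  - exists 1%Z. now rewrite gpow_1.
  - now exists 0%Z.
  - exists (i + j)%Z. now rewrite gpow_add, hi, hj.
  - exists (- i)%Z. now rewrite gpow_opp, hi.
Qed.

Lemma Cyc_order i : cg tt ^ i = 1 <-> (Z.of_nat n | i)%Z.
Proof.
  split.
  (* The homomorphism to [Zmod n] sending the generator to the class of 1 detects the exponent
     modulo [n]. *)
  - intros h. destruct (Cyc_hom (Zmod (Z.of_nat n)) (zcls _ 1)) as (f & hf & hfc).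
    { rewrite zcls_pow. apply zcls_eq. exists 1%Z; lia. }
    apply (f_equal f) in h. rewrite (hom_pow hf), (hom_one hf), hfc in h.
    rewrite zcls_pow in h. apply zcls_eq in h.
    now replace i with (1 * i - 0)%Z by lia.
  - intros h. rewrite <- (gpow_0 (cg tt)).
    apply gpow_congr with (Z.of_nat n); [apply Cyc_rel|].
    now rewrite Z.sub_0_r.
Qed.

End Cyclic.

Section FreeProduct.
Context {m1 m2 r : nat} {F : Grp} {fg : HGen r -> F}
  (hF : is_presented (FPRel m1 m2 r) F fg).

Lemma FP_a : fg HA ^ Z.of_nat m1 = 1.
Proof.
  pose proof (proj1 hF _ _ (fp_a m1 m2 r)) as h. now rewrite weval_wpow in h.
Qed.

Lemma FP_b : fg HB ^ Z.of_nat m2 = 1.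
Proof.
  pose proof (proj1 hF _ _ (fp_b m1 m2 r)) as h. now rewrite weval_wpow in h.
Qed.

End FreeProduct.

Fixpoint fprod {G : Grp} {r : nat} : (Fin.t r -> G) -> G :=
  match r with
  | O => fun _ => 1
  | S r => fun f => f Fin.F1 * fprod (fun i => f (Fin.FS i))
  end.

Definition delta {r : nat} (i j : Fin.t r) : Z :=
  if Fin.eq_dec i j then 1%Z else 0%Z.

Lemma fprod_ext {G : Grp} {r} (f g : Fin.t r -> G) :
  (forall i, f i = g i) -> fprod f = fprod g.
Proof. intros h. f_equal. now apply functional_extensionality. Qed.

Lemma fprod_one {G : Grp} {r} : fprod (fun _ : Fin.t r => gone : G) = 1.
Proof. induction r; simpl; auto. now rewrite IHr, gmul1l. Qed.

Lemma fprod_mul {G : Grp} {r} (f g : Fin.t r -> G) :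
  (forall x y : G, commute x y) ->
  fprod (fun i => f i * g i) = fprod f * fprod g.
Proof.
  intros hc. induction r; simpl.
  - now gsimpl.
  - rewrite IHr. gsimpl. f_equal. rewrite !gmulA. f_equal. apply hc.
Qed.

Lemma fprod_inv {G : Grp} {r} (f : Fin.t r -> G) :
  (forall x y : G, commute x y) ->
  fprod (fun i => ginv (f i)) = ginv (fprod f).
Proof.
  intros hc. symmetry. apply ginv_unique. rewrite <- fprod_mul by auto.
  rewrite <- (@fprod_one G r). apply fprod_ext. intros; apply gmulVr.
Qed.

Lemma hom_fprod {G K : Grp} {r} (h : G -> K) (f : Fin.t r -> G) :
  is_hom h -> h (fprod f) = fprod (fun i => h (f i)).
Proof.
  intros hh. induction r; simpl.
  - apply (hom_one hh).
  - now rewrite hh, IHr.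
Qed.

Lemma delta_FS {r} (i j : Fin.t r) : delta (Fin.FS i) (Fin.FS j) = delta i j.
Proof.
  unfold delta.
  destruct (Fin.eq_dec i j) as [->|h], (Fin.eq_dec (Fin.FS _) _) as [h'|h'];
    auto.
  - now contradict h'.
  - now apply Fin.FS_inj in h'.
Qed.

Lemma fprod_delta {G : Grp} {r} (i : Fin.t r) (f : Fin.t r -> G) :
  fprod (fun j => f j ^ delta i j) = f i.
Proof.
  induction i; cbn [fprod].
  - rewrite (fprod_ext _ (fun _ => gone)).
    + rewrite fprod_one. unfold delta.
      destruct (Fin.eq_dec _ _) as [h|h]; [|now contradict h].
      now rewrite gpow_1, gmul1r.
    + intros j. unfold delta.
      destruct (Fin.eq_dec _ _) as [h|h]; [discriminate|reflexivity].
  - rewrite (fprod_ext _ (fun j => f (Fin.FS j) ^ delta i j)).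
    + rewrite (IHi (fun j => f (Fin.FS j))). unfold delta.
      destruct (Fin.eq_dec _ _) as [h|h]; [discriminate|].
      now rewrite gpow_0, gmul1l.
    + intros j. now rewrite delta_FS.
Qed.

(** * The abelian group [Z_k x Z^r] and its cyclic torsion *)

Section Abelian.
Context {k r : nat} {A : Grp} {ag : option (Fin.t r) -> A}
  (hA : is_presented (AbRel k r) A ag).

Lemma Ab_rel : ag None ^ Z.of_nat k = 1.
Proof.
  pose proof (proj1 hA _ _ (ab_tor k r)) as h. now rewrite weval_wpow in h.
Qed.

Lemma Ab_comm (x y : A) : commute x y.
Proof.
  apply (presented_central hA). intros i.
  apply commute_sym, (presented_central hA). intros j.
  apply commutator_eq1. exact (proj1 hA _ _ (ab_comm k r i j)).
Qed.

Lemma Ab_hom (K : Grp) (s : option (Fin.t r) -> K) :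
  s None ^ Z.of_nat k = 1 -> (forall x y : K, commute x y) ->
  exists f : A -> K, is_hom f /\ forall x, f (ag x) = s x.
Proof.
  intros hs hc. apply (presented_hom hA). intros u v [|x y].
  - now rewrite weval_wpow.
  - apply commutator_eq1, hc.
Qed.

Lemma Ab_order i : ag None ^ i = 1 <-> (Z.of_nat k | i)%Z.
Proof.
  split.
  - intros h. destruct (Ab_hom (Zmod (Z.of_nat k))
      (fun x => match x with None => zcls _ 1 | Some _ => 1 end))
      as (f & hf & hfc).
    { rewrite zcls_pow. apply zcls_eq. exists 1%Z; lia. }
    { apply Zmod_comm. }
    apply (f_equal f) in h. rewrite (hom_pow hf), (hom_one hf), hfc in h.
    rewrite zcls_pow in h. apply zcls_eq in h.
    now replace i with (1 * i - 0)%Z by lia.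
  - intros h. rewrite <- (gpow_0 (ag None)).
    apply gpow_congr with (Z.of_nat k); [apply Ab_rel|].
    now rewrite Z.sub_0_r.
Qed.

Lemma Ab_normal_form y :
  exists i (e : Fin.t r -> Z), y = ag None ^ i * fprod (fun j => ag (Some j) ^ e j).
Proof.
  destruct (presented_word hA y) as [w <-].
  induction w as [[j|]| |u (i & e & hu) v (i' & e' & hv)|u (i & e & hu)]; simpl.
  - exists 0%Z, (delta j). rewrite (fprod_delta j (fun j => ag (Some j))).
    now rewrite gpow_0, gmul1l.
  - exists 1%Z, (fun _ => 0%Z).
    now rewrite (fprod_ext _ (fun _ => 1)), fprod_one, gpow_1, gmul1r.
  - exists 0%Z, (fun _ => 0%Z).
    now rewrite (fprod_ext _ (fun _ => 1)), fprod_one, gpow_0, gmul1r.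
  - exists (i + i')%Z, (fun j => (e j + e' j)%Z). rewrite hu, hv.
    rewrite (fprod_ext (fun j => ag (Some j) ^ (e j + e' j))
      (fun j => ag (Some j) ^ e j * ag (Some j) ^ e' j))
      by (intros; apply gpow_add).
    rewrite fprod_mul, gpow_add by apply Ab_comm. gsimpl. f_equal.
    rewrite !gmulA. f_equal. apply Ab_comm.
  - exists (- i)%Z, (fun j => (- e j)%Z). rewrite hu.
    rewrite (fprod_ext (fun j => ag (Some j) ^ (- e j))
      (fun j => ginv (ag (Some j) ^ e j)))
      by (intros; apply gpow_opp).
    rewrite fprod_inv, gpow_opp by apply Ab_comm. gsimpl. apply Ab_comm.
Qed.

Lemma Ab_torsion y N : N <> 0%Z -> y ^ N = 1 -> exists i, y = ag None ^ i.
Proof.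
  intros hN hy. destruct (Ab_normal_form y) as (i & e & he).
  exists i. enough (h0 : forall j, e j = 0%Z).
  { rewrite he, (fprod_ext _ (fun _ => 1)), fprod_one.
    - apply gmul1r.
    - intros j. now rewrite h0. }
  (* Project to the [j]-th free coordinate in [Zmod 0], a copy of the integers: there [e j * N = 0]
     forces [e j = 0]. *)
  intros j. destruct (Ab_hom (Zmod 0)
    (fun x => match x with None => 1 | Some i => zcls _ (delta j i) end))
    as (f & hf & hfc).
  { apply gpow_one. }
  { apply Zmod_comm. }
  assert (hfy : f y = zcls 0 (e j)).
  { rewrite he, hf, (hom_pow hf), hfc, gpow_one, gmul1l, hom_fprod by auto.
    rewrite <- (fprod_delta j (fun j => zcls 0 (e j))). apply fprod_ext.
    intros i'. rewrite (hom_pow hf), hfc, !zcls_pow. f_equal. lia. }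
  apply (f_equal f) in hy. rewrite (hom_pow hf), (hom_one hf), hfy in hy.
  rewrite zcls_pow in hy. apply zcls_eq in hy. destruct hy as [q hq]. nia.
Qed.

(* Both images of [t] and [x] in the abelianization lie in the cyclic torsion
   subgroup, so [Hom(G, Z/d)] cannot separate them. *)
Lemma cyclic_torsion_homs {G : Grp} (phi : G -> A) (t x : G) (N M d : Z)
    (h1 h2 : G -> Zmod d) :
  is_hom phi -> surjective phi -> (forall g, phi g = 1 -> in_commutator g) ->
  N <> 0%Z -> phi t ^ N = 1 -> M <> 0%Z -> phi x ^ M = 1 ->
  is_hom h1 -> is_hom h2 ->
  h1 t = zcls d 1 -> h1 x = zcls d 0 -> h2 x = zcls d 1 ->
  (d | 1)%Z.
Proof.
  intros hphi hs hk hN ht hM hx hh1 hh2 h1t h1x h2x.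
  destruct (Ab_torsion _ N hN ht) as [i hi].
  destruct (Ab_torsion _ M hM hx) as [j hj].
  destruct (hs (ag None)) as [c hc].
  (* Having an abelian target, [h] kills the kernel of [phi]; and [y] and [c ^ e] have the same
     image under [phi]. *)
  assert (hpow : forall (h : G -> Zmod d) y e, is_hom h -> phi y = ag None ^ e ->
    h y = h c ^ e).
  { intros h y e hh hy. apply gmulV_eq1.
    rewrite <- (hom_inv hh), <- (hom_pow hh), <- hh.
    apply (hom_commutator hh); [apply Zmod_comm|]. apply hk.
    rewrite hphi, (hom_inv hphi), (hom_pow hphi), hy, hc. apply gmulVl. }
  destruct (zcls_surj d (h1 c)) as [a ha], (zcls_surj d (h2 c)) as [b hb].
  rewrite (hpow h1 t i), ha, zcls_pow in h1t by auto.
  rewrite (hpow h1 x j), ha, zcls_pow in h1x by auto.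
  rewrite (hpow h2 x j), hb, zcls_pow in h2x by auto.
  apply zcls_eq in h1t, h1x, h2x.
  destruct h1t as [q1 e1], h1x as [q2 e2], h2x as [q3 e3].
  (* 1 = b j - q3 d, and j = j a i - j q1 d = (q2 i - j q1) d *)
  exists (b * (q2 * i - j * q1) - q3)%Z.
  assert (haj : (a * j = q2 * d)%Z) by lia.
  assert (hai : (a * i = 1 + q1 * d)%Z) by lia.
  assert (hj' : (j = (q2 * i - j * q1) * d)%Z).
  { assert (hij : (j * (a * i) = (a * j) * i)%Z) by ring.
    rewrite haj, hai in hij. lia. }
  transitivity (b * j - q3 * d)%Z; [lia|].
  rewrite hj' at 1. ring.
Qed.

End Abelian.

(** * The quotient by the commutator subgroup *)

Section Abelianization.
Context (G : Grp).

(** From [y^-1 x y = x [x, y]]. This normality makes multiplication well defined on cosets. *)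
Lemma in_commutator_conj (x y : G) :
  in_commutator x -> in_commutator (ginv y * (x * y)).
Proof.
  intros hx. replace (ginv y * (x * y)) with (x * (ginv x * ginv y * (x * y)))
    by now gsimpl.
  apply ic_mul; auto. apply ic_comm.
Qed.

Lemma abelianized_congruence :
  group_congruence G gmul gone ginv (fun x y => in_commutator (ginv x * y)).
Proof.
  split; intros; gsimpl; auto using ic_one.
  - replace (ginv y * x) with (ginv (ginv x * y)) by now gsimpl.
    now apply ic_inv.
  - replace (ginv x * z) with (ginv x * y * (ginv y * z)) by now gsimpl.
    now apply ic_mul.
  - replace (ginv y * (ginv x * (x' * y')))
      with (ginv y * ((ginv x * x') * y) * (ginv y * y')) by now gsimpl.
    apply ic_mul; auto. now apply in_commutator_conj.
  - replace (x * ginv x') with (ginv (ginv x) * (ginv (ginv x * x') * ginv x))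
      by now gsimpl.
    now apply in_commutator_conj, ic_inv.
Qed.

Definition abelianized : Grp := quotGrp _ _ _ _ _ abelianized_congruence.

Lemma abelianized_hom : is_hom (fun x : G => qcls x : abelianized).
Proof.
  intros x y. symmetry. exact (qmul_cls _ _ _ _ _ abelianized_congruence x y).
Qed.

Lemma abelianized_ker (x : G) :
  (qcls x : abelianized) = 1 -> in_commutator x.
Proof.
  intros h. symmetry in h.
  apply (qcls_eq _ _ _ _ _ abelianized_congruence) in h.
  now rewrite ginv1, gmul1l in h.
Qed.

Lemma abelianized_comm (x y : abelianized) : commute x y.
Proof.
  pose proof abelianized_hom as hq.
  destruct x as [P [x ->]], y as [P' [y ->]].
  change (commute (qcls x : abelianized) (qcls y)). unfold commute.
  rewrite <- (hq x y), <- (hq y x).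
  apply (qcls_eq _ _ _ _ _ abelianized_congruence).
  gsimpl. rewrite gmulA.
  apply ic_comm.
Qed.

End Abelianization.

(** * The group [H]: extension, abelianization, uniqueness *)

Section HGroup.
Context {n m1 m2 r : nat} (hn : 0 < n) (hm1 : 0 < m1) (hm2 : 0 < m2)
  (hcop : rel_prime (Z.of_nat m1) (Z.of_nat m2))
  {H : Grp} {hgen : HGen r -> H} (hH : is_presented (HRel n m1 m2 r) H hgen).

Notation za := (hgen HA ^ Z.of_nat m1).

Lemma H_ab : za = hgen HB ^ Z.of_nat m2.
Proof.
  pose proof (proj1 hH _ _ (h_ab n m1 m2 r)) as h. now rewrite !weval_wpow in h.
Qed.

Lemma H_order : za ^ Z.of_nat n = 1.
Proof.
  pose proof (proj1 hH _ _ (h_ord n m1 m2 r)) as h. rewrite weval_wpow in h.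
  now rewrite gpow_mul, <- Nat2Z.inj_mul.
Qed.

(** It commutes with each [x_i] by a relation, with [a] as a power of [a], and with [b] because it
    is also a power of [b]. *)
Lemma H_central : central za.
Proof.
  apply (presented_central hH). intros [i| |].
  - apply commutator_eq1.
    pose proof (proj1 hH _ _ (h_comm n m1 m2 r i)) as h. simpl in h.
    now rewrite weval_wpow in h.
  - apply commute_sym, commute_pow. reflexivity.
  - rewrite H_ab. apply commute_sym, commute_pow. reflexivity.
Qed.

Lemma H_hom (K : Grp) (s : HGen r -> K) :
  s HA ^ Z.of_nat m1 = s HB ^ Z.of_nat m2 ->
  (s HA ^ Z.of_nat m1) ^ Z.of_nat n = 1 ->
  (forall i, commute (s HA ^ Z.of_nat m1) (s (HX i))) ->
  exists f : H -> K, is_hom f /\ forall x, f (hgen x) = s x.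
Proof.
  intros h1 h2 h3. apply (presented_hom hH). intros u v [| |i].
  - now rewrite !weval_wpow.
  - now rewrite weval_wpow, Nat2Z.inj_mul, <- gpow_mul.
  - unfold wcomm. cbn [weval]. rewrite weval_wpow. now apply commutator_eq1.
Qed.

(** With [w'] inverse to [w] modulo [n], the map from [G] must send [t] to [za ^ w'], whose [w]-th
    power is [za]; the map back sends generators to their lifts. *)
Lemma H_lifted_iso {F : Grp} {fg : HGen r -> F} {G : Grp} {t : G} {pi : G -> F}
    {gen : HGen r -> G} {w : Z} :
  is_presented (FPRel m1 m2 r) F fg ->
  lifted_extension (n := n) (m1 := m1) (m2 := m2) (fg := fg) G t pi gen w w ->
  rel_prime w (Z.of_nat n) -> Iso G H /\ Iso H G.
Proof.
  intros hF hG hw. destruct (rel_prime_inverse _ _ hw) as [w' hw'].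
  assert (hz : (za ^ w') ^ w = za).
  { rewrite gpow_mul. rewrite <- (gpow_1 za) at 2.
    apply gpow_congr with (Z.of_nat n); [apply H_order|].
    now rewrite Z.mul_comm. }
  destruct (lifted_hom hF hG H hgen (za ^ w')) as (f & hf & hfx & hft).
  - apply central_pow, H_central.
  - rewrite gpow_mul, Z.mul_comm, <- gpow_mul, H_order. apply gpow_one.
  - now rewrite hz.
  - now rewrite hz, H_ab.
  - pose proof (proj2 (le_order _ _ _ _ _ _ hG (Z.of_nat n)) (Z.divide_refl _))
      as htn.
    destruct (H_hom G gen) as (h & hh & hhx).
    + now rewrite (le_a _ _ _ _ _ _ hG), (le_b _ _ _ _ _ _ hG).
    + now rewrite (le_a _ _ _ _ _ _ hG), gpow_mul, Z.mul_comm, <- gpow_mul,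
        htn, gpow_one.
    + intros i. rewrite (le_a _ _ _ _ _ _ hG).
      apply central_pow, (le_central _ _ _ _ _ _ hG).
    + assert (hfh : forall y, f (h y) = y).
      { apply (presented_hom_eq hH (fun y => f (h y)) (fun y => y)).
        - now apply hom_comp.
        - intros a b; auto.
        - intros x. now rewrite hhx. }
      (* [t] returns as [t ^ (w * w')], and [w * w'] is 1 modulo [n]. *)
      assert (hht : h (f t) = t).
      { rewrite hft, !(hom_pow hh), hhx, (le_a _ _ _ _ _ _ hG), gpow_mul.
        rewrite <- (gpow_1 t) at 2. now apply gpow_congr with (Z.of_nat n). }
      assert (hhf : forall g, h (f g) = g).
      { intros g. destruct (lifted_word hF hG g) as (v & i & ->).
        rewrite hf, hh, (hom_pow hf), (hom_pow hh), hht, (hom_weval hf),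
          (hom_weval hh).
        f_equal. apply weval_ext. intros x. now rewrite hfx. }
      split; [exact (Iso_of_inverse f h hf hhf hfh)
             |exact (Iso_of_inverse h f hh hfh hhf)].
Qed.

(** The direct product is the extension with [s = l = 0]. Multiplying the lifts by [t ^ m2] and
    [t ^ m1] makes both exponents [m1 * m2], which is prime to [n]. *)
Lemma H_product (C : Grp) (cg : unit -> C) (F : Grp) (fg : HGen r -> F) :
  rel_prime (Z.of_nat n) (Z.of_nat m1 * Z.of_nat m2) ->
  is_presented (CycRel n) C cg -> is_presented (FPRel m1 m2 r) F fg ->
  Iso H (prodGrp C F).
Proof.
  intros hnm hC hF.
  assert (hl : lifted_extension (n := n) (m1 := m1) (m2 := m2) (fg := fg)
    (prodGrp C F) (cg tt, 1) (fun x => snd x) (fun x => (1, fg x)) 0 0).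
  { split; auto.
    - intros [x y]. unfold commute; simpl. rewrite gmul1l, gmul1r. f_equal.
      destruct (Cyc_pow hC x) as [i ->].
      rewrite <- (gpow_1 (cg tt)) at 1 4. apply commute_pow_pow.
    - intros i. rewrite prod_pow. simpl. rewrite gpow_one.
      rewrite <- (Cyc_order hC). split; congruence.
    - apply snd_hom.
    - intros [x y] hy. simpl in hy. destruct (Cyc_pow hC x) as [i ->].
      exists i. rewrite prod_pow. simpl. now rewrite gpow_one, hy.
    - rewrite prod_pow. simpl. now rewrite gpow_one, (FP_a hF).
    - rewrite prod_pow. simpl. now rewrite gpow_one, (FP_b hF). }
  destruct (lifted_modify hl (Z.of_nat m2) (Z.of_nat m1)) as [gen' hl'].
  rewrite (Z.mul_comm (Z.of_nat m2)) in hl'.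
  apply (H_lifted_iso hF hl'). now apply rel_prime_sym.
Qed.

Lemma H_unique (G : Grp) : HCond n m1 m2 r G -> Iso G H.
Proof.
  intros [(C & cg & F & fg & hC & hF & iota & pi & hi & hinj & hcen & hpi & hsur & hker)
    (A & ag & hA & phi & hphi & hphis & hphik)].
  set (t := iota (cg tt)).
  assert (htc : central t) by (intros g; apply hcen).
  assert (hto : forall i, t ^ i = 1 <-> (Z.of_nat n | i)%Z).
  { intros i. unfold t. rewrite <- (hom_pow hi), <- (Cyc_order hC). split.
    - intros h. apply hinj. now rewrite h, (hom_one hi).
    - intros ->. apply (hom_one hi). }
  assert (hk : forall g, pi g = 1 -> exists i, g = t ^ i).
  { intros g hg. apply hker in hg. destruct hg as [c <-].
    destruct (Cyc_pow hC c) as [i ->]. exists i. apply (hom_pow hi). }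
  set (gen := fun x => proj1_sig
    (constructive_indefinite_description _ (hsur (fg x)))).
  assert (hgen' : forall x, pi (gen x) = fg x).
  { intros x. exact (proj2_sig
      (constructive_indefinite_description _ (hsur (fg x)))). }
  destruct (hk (gen HA ^ Z.of_nat m1)) as [s hs].
  { now rewrite (hom_pow hpi), hgen', (FP_a hF). }
  destruct (hk (gen HB ^ Z.of_nat m2)) as [l hl].
  { now rewrite (hom_pow hpi), hgen', (FP_b hF). }
  assert (hG : lifted_extension (n := n) (m1 := m1) (m2 := m2) (fg := fg)
    G t pi gen s l).
  { split; auto. apply hker. now exists (cg tt). }
  assert (htn : t ^ Z.of_nat n = 1) by (apply hto, Z.divide_refl).
  assert (hker' : forall g, phi g = 1 -> in_commutator g) by (intros g; apply hphik).
  assert (htor : forall x m e, x ^ Z.of_nat m = t ^ e ->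
    phi x ^ (Z.of_nat m * Z.of_nat n) = 1).
  { intros x m e hx. rewrite <- (hom_pow hphi), <- gpow_mul, hx, gpow_mul.
    now rewrite Z.mul_comm, <- gpow_mul, htn, gpow_one, (hom_one hphi). }
  destruct (rel_prime_bezout _ _ hcop) as [u v huv].
  destruct (common_unit (Z.of_nat m1) (Z.of_nat m2) (Z.of_nat n) s l)
    as (w & j & k & hw1 & hw2 & hw); [lia|auto| | |].
  - intros d [s' hds] [m' hdm] [n' hdn].
    (* [h1] sends [t] to 1 and [a] to 0, which is consistent as [d] divides [s]. Sending [b] to
       [l * v] respects [b^m2 = t^l], since [v * m2 = 1 - u * m1] is 1 modulo [d]. *)
    destruct (lifted_hom hF hG (Zmod d) (fun x => match x with
      | HB => zcls d (l * v) | _ => 1 end) (zcls d 1)) as (h1 & hh1 & h1x & h1t).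
    { intros y. apply Zmod_comm. }
    { rewrite zcls_pow. apply zcls_eq. exists n'. lia. }
    { rewrite gpow_one, zcls_pow. apply zcls_eq. exists (- s')%Z. lia. }
    { rewrite !zcls_pow. apply zcls_eq. exists (- l * u * m')%Z.
      replace (l * v * Z.of_nat m2)%Z with (l * (v * Z.of_nat m2))%Z by ring.
      replace (v * Z.of_nat m2)%Z with (1 - u * (m' * d))%Z by lia. ring. }
    (* [h2] sends [a] to 1 and [t] to 0, which is consistent as [d] divides [m1]. *)
    destruct (lifted_hom hF hG (Zmod d) (fun x => match x with
      | HA => zcls d 1 | _ => 1 end) 1) as (h2 & hh2 & h2x & h2t).
    { intros y. apply Zmod_comm. }
    { apply gpow_one. }
    { rewrite gpow_one, zcls_pow. apply zcls_eq. exists m'. lia. }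
    { now rewrite !gpow_one. }
    apply (cyclic_torsion_homs hA phi t (gen HA) (Z.of_nat n)
      (Z.of_nat m1 * Z.of_nat n) d h1 h2); auto; try lia.
    + now rewrite <- (hom_pow hphi), htn, (hom_one hphi).
    + now apply htor with s.
  (* The same pair of homomorphisms with [a] and [b] exchanged; [a] now goes to [s * u]. *)
  - intros d [s' hds] [m' hdm] [n' hdn].
    destruct (lifted_hom hF hG (Zmod d) (fun x => match x with
      | HA => zcls d (s * u) | _ => 1 end) (zcls d 1)) as (h1 & hh1 & h1x & h1t).
    { intros y. apply Zmod_comm. }
    { rewrite zcls_pow. apply zcls_eq. exists n'. lia. }
    { rewrite !zcls_pow. apply zcls_eq. exists (- s * v * m')%Z.
      replace (s * u * Z.of_nat m1)%Z with (s * (u * Z.of_nat m1))%Z by ring.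
      replace (u * Z.of_nat m1)%Z with (1 - v * (m' * d))%Z by lia. ring. }
    { rewrite gpow_one, zcls_pow. apply zcls_eq. exists (- s')%Z. lia. }
    destruct (lifted_hom hF hG (Zmod d) (fun x => match x with
      | HB => zcls d 1 | _ => 1 end) 1) as (h2 & hh2 & h2x & h2t).
    { intros y. apply Zmod_comm. }
    { apply gpow_one. }
    { now rewrite !gpow_one. }
    { rewrite gpow_one, zcls_pow. apply zcls_eq. exists m'. lia. }
    apply (cyclic_torsion_homs hA phi t (gen HB) (Z.of_nat n)
      (Z.of_nat m2 * Z.of_nat n) d h1 h2); auto; try lia.
    + now rewrite <- (hom_pow hphi), htn, (hom_one hphi).
    + now apply htor with l.
  - destruct (lifted_modify hG j k) as [gen' hl'].
    rewrite <- hw1, <- hw2 in hl'. apply (H_lifted_iso hF hl' hw).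
Qed.

(** If [c] generates the cyclic factor, [a = c^m2] and [b = c^m1] satisfy
    [a^m1 = b^m2 = c^(m1 m2)]. *)
Lemma H_to_abelian {k : nat} {A : Grp} {ag : option (Fin.t r) -> A} :
  is_presented (AbRel k r) A ag -> k = (n * m1 * m2)%nat ->
  exists phi : H -> A, is_hom phi /\ forall x, phi (hgen x) = match x with
    | HA => ag None ^ Z.of_nat m2
    | HB => ag None ^ Z.of_nat m1
    | HX i => ag (Some i)
    end.
Proof.
  intros hA hk. apply H_hom.
  - rewrite !gpow_mul. f_equal; lia.
  - rewrite !gpow_mul. apply (Ab_order hA). exists 1%Z. lia.
  - intros i. apply (Ab_comm hA).
Qed.

(** That [za] has no smaller order is seen in the abelian group: its image is the [m1 m2]-th power
    of a generator of order [n m1 m2]. *)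
Lemma H_order_iff i : za ^ i = 1 <-> (Z.of_nat n | i)%Z.
Proof.
  split.
  - intros h. pose proof (wordGrp_presented (AbRel (n * m1 * m2) r)) as hA.
    destruct (H_to_abelian hA eq_refl) as (phi & hphi & hphix).
    apply (f_equal phi) in h.
    rewrite !(hom_pow hphi), (hom_one hphi), hphix, !gpow_mul in h.
    apply (Ab_order hA) in h. destruct h as [q hq]. exists q.
    apply (Z.mul_reg_l _ _ (Z.of_nat m1 * Z.of_nat m2)); [nia|lia].
  - intros h. rewrite <- (gpow_0 za).
    apply gpow_congr with (Z.of_nat n); [apply H_order|].
    now rewrite Z.sub_0_r.
Qed.

Lemma H_central_ext : central_ext_cond n m1 m2 r H.
Proof.
  pose proof (wordGrp_presented (CycRel n)) as hC.
  pose proof (wordGrp_presented (FPRel m1 m2 r)) as hF.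
  exists (wordGrp (CycRel n)), (wordgen _),
    (wordGrp (FPRel m1 m2 r)), (wordgen _).
  split; [exact hC|]. split; [exact hF|].
  destruct (Cyc_hom hC H za H_order) as (iota & hi & hit).
  destruct (H_hom (wordGrp (FPRel m1 m2 r)) (wordgen _)) as (pi & hpi & hpix).
  { now rewrite (FP_a hF), (FP_b hF). }
  { now rewrite (FP_a hF), gpow_one. }
  { intros i. rewrite (FP_a hF). apply commute_sym, commute_one. }
  assert (hip : forall i, iota (wordgen (CycRel n) tt ^ i) = za ^ i).
  { intros i. now rewrite (hom_pow hi), hit. }
  exists iota, pi. split; [auto|]. split; [|split; [|split; [auto|split]]].
  - intros x y. destruct (Cyc_pow hC x) as [i ->], (Cyc_pow hC y) as [j ->].
    rewrite !hip. intros h. apply gmulV_eq1. apply (proj2 (gmulV_eq1 _ _)) in h.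
    rewrite <- gpow_opp, <- gpow_add in h. rewrite <- gpow_opp, <- gpow_add.
    apply H_order_iff in h. now apply (Cyc_order hC).
  - intros c g. destruct (Cyc_pow hC c) as [i ->]. rewrite hip.
    apply central_pow, H_central.
  - intros y. destruct (presented_word hF y) as [w <-].
    exists (weval hgen w). rewrite (hom_weval hpi). now apply weval_ext.
  - intros g. split.
    (* [FP_cong_shift] is used with [t = za] and [s = l = 1]: a word trivial in the free product is
       a power of [za] in [H]. *)
    + intros hg. destruct (presented_word hH g) as [w <-].
      rewrite (hom_weval hpi), (weval_ext _ _ w hpix) in hg.
      apply (presented_cong hF w WOne) in hg.
      destruct (FP_cong_shift m1 m2 r H hgen za 1 1) with (u := w)
        (v := @WOne (HGen r)) as [k hk]; auto.
      * apply H_central.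
      * now rewrite gpow_1.
      * now rewrite gpow_1, H_ab.
      * exists (wordgen (CycRel n) tt ^ k). rewrite hip, hk. simpl.
        now rewrite gmul1l.
    + intros [c <-]. destruct (Cyc_pow hC c) as [i ->].
      rewrite hip, !(hom_pow hpi), hpix, (FP_a hF). apply gpow_one.
Qed.

Lemma H_abelianization : abelianization_cond (n * m1 * m2) r H.
Proof.
  pose proof (wordGrp_presented (AbRel (n * m1 * m2) r)) as hA.
  set (A := wordGrp _) in hA. set (ag := wordgen _) in hA.
  exists A, ag. split; [exact hA|].
  destruct (H_to_abelian hA eq_refl) as (phi & hphi & hphix).
  destruct (rel_prime_bezout _ _ hcop) as [v u huv].
  (* Since [u * m2 + v * m1 = 1], this element maps onto the generator of the cyclic factor. *)
  set (c := hgen HA ^ u * hgen HB ^ v).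
  assert (hpc : phi c = ag None).
  { unfold c. rewrite hphi, !(hom_pow hphi), !hphix, !gpow_mul, <- gpow_add.
    apply gpow_id. lia. }
  exists phi. split; [auto|]. split.
  - intros y. destruct (presented_word hA y) as [w <-].
    exists (weval (fun x => match x with None => c | Some i => hgen (HX i) end) w).
    rewrite (hom_weval hphi). apply weval_ext.
    now intros [i|].
  - intros g. split; [|apply (hom_commutator hphi), (Ab_comm hA)].
    set (Q := abelianized H). set (q := fun x : H => qcls x : Q).
    pose proof (abelianized_hom H : is_hom q) as hq.
    pose proof (abelianized_comm H : forall x y : Q, commute x y) as hQ.
    (* [psi] is built so that [psi] after [phi] is the quotient map [q]; the kernel of [phi] then
       lies in that of [q], the commutator subgroup. *)
    destruct (Ab_hom hA Q (fun x => match x with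
      | None => q c | Some i => q (hgen (HX i)) end)) as (psi & hpsi & hpsix);
      auto.
    { unfold c. rewrite hq, gpow_mul_commute by apply hQ.
      rewrite !(hom_pow hq), !gpow_mul.
      rewrite <- (hom_pow hq (hgen HA)), <- (hom_pow hq (hgen HB)).
      replace (u * Z.of_nat (n * m1 * m2))%Z
        with (Z.of_nat m1 * Z.of_nat n * (u * Z.of_nat m2))%Z by lia.
      replace (v * Z.of_nat (n * m1 * m2))%Z
        with (Z.of_nat m2 * Z.of_nat n * (v * Z.of_nat m1))%Z by lia.
      rewrite <- !gpow_mul, <- H_ab, H_order, !gpow_one, (hom_one hq).
      apply gmul1l. }
    assert (hpq : forall x, psi (phi x) = q x).
    { assert (hab : q (hgen HA) ^ Z.of_nat m1 = q (hgen HB) ^ Z.of_nat m2)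
        by now rewrite <- !(hom_pow hq), H_ab.
      apply (presented_hom_eq hH (fun x => psi (phi x)) q); auto.
      { now apply hom_comp. }
      intros [i| |]; rewrite hphix, ?(hom_pow hpsi), hpsix; auto; unfold c;
        rewrite hq, gpow_mul_commute by apply hQ; rewrite !(hom_pow hq), !gpow_mul.
      (* In [Q], [c^m2 = a^(u m2) b^(v m2) = a^(u m2 + v m1) = a]; the case of [b] is symmetric. *)
      - rewrite (Z.mul_comm v), <- (gpow_mul _ (Z.of_nat m2)), <- hab, gpow_mul.
        rewrite <- gpow_add. apply gpow_id. lia.
      - rewrite (Z.mul_comm u), <- (gpow_mul _ (Z.of_nat m1)), hab, gpow_mul.
        rewrite <- gpow_add. apply gpow_id. lia. }
    intros hg. apply (abelianized_ker H). fold Q. change (q g = 1).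
    now rewrite <- hpq, hg, (hom_one hpsi).
Qed.

End HGroup.

(** * Oka's groups *)

Fixpoint dprod {G : Grp} (f : nat -> G) (k : nat) : G :=
  match k with
  | O => 1
  | S k => f k * dprod f k
  end.

Section DecreasingProducts.
Context {G : Grp}.
Implicit Types f g : nat -> G.

Lemma dprod_ext f g k : (forall i, i < k -> f i = g i) -> dprod f k = dprod g k.
Proof.
  induction k; simpl; intros h; auto. rewrite h, IHk; auto.
Qed.

Lemma dprod_add f j k :
  dprod f (j + k) = dprod (fun i => f (i + k)%nat) j * dprod f k.
Proof. induction j; simpl; [|rewrite IHj]; now gsimpl. Qed.

Lemma dprod_conj f c k :
  dprod (fun i => c * f i * ginv c) k = c * dprod f k * ginv c.
Proof. induction k; simpl; [|rewrite IHk]; now gsimpl. Qed.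

(* With [c = W^u], the twisted blocks telescope:
   [W^(u(k-1)) D W^(-u(k-1)) ... W^u D W^(-u) D = W^(uk) (W^(-u) D)^k]. *)
Lemma dprod_blocks f c R k :
  (forall i, f (i + R)%nat = c * f i * ginv c) ->
  dprod f (k * R) = c ^ Z.of_nat k * (ginv c * dprod f R) ^ Z.of_nat k.
Proof.
  intros hf.
  assert (hfk : forall k i, f (i + k * R)%nat
    = c ^ Z.of_nat k * f i * ginv (c ^ Z.of_nat k)).
  { clear k. induction k; intros i.
    - rewrite gpow_0. cbn [Nat.mul]. rewrite Nat.add_0_r. now gsimpl.
    - replace (i + S k * R)%nat with (i + k * R + R)%nat by (simpl; lia).
      rewrite hf, IHk, Nat2Z.inj_succ, gpow_succ. now gsimpl. }
  induction k.
  - simpl. now gsimpl.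
  - cbn [Nat.mul]. rewrite dprod_add, IHk.
    rewrite (dprod_ext _ (fun i => c ^ Z.of_nat k * f i * ginv (c ^ Z.of_nat k)))
      by (intros; apply hfk).
    rewrite dprod_conj, Nat2Z.inj_succ, !gpow_succ.
    replace (c * c ^ Z.of_nat k) with (c ^ Z.of_nat k * c)
      by (symmetry; now apply commute_pow).
    now gsimpl.
Qed.

Lemma weval_okaprod (s : OkaGen -> G) k :
  weval s (okaprod k) = dprod (fun i => s (OA (Z.of_nat i))) k.
Proof. induction k; simpl; congruence. Qed.

End DecreasingProducts.

Lemma hom_dprod {G K : Grp} (h : G -> K) f k :
  is_hom h -> h (dprod f k) = dprod (fun i => h (f i)) k.
Proof.
  intros hh. induction k; simpl.
  - apply (hom_one hh).
  - now rewrite hh, IHk.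
Qed.

(** * Oka's group, for a Bezout pair [u, v] with [v] invertible modulo [n m2] *)

Section Oka.
Context {n m1 m2 r : nat} {u v v' : Z}
  (huv : (u * Z.of_nat m1 + v * Z.of_nat m2 = 1)%Z)
  (hv : (Z.of_nat (n * m2) | v * v' - 1)%Z)
  {O : Grp} {og : OkaGen -> O}
  (hO : is_presented (OkaRel ((r + 1) * m1) ((r + 1) * m2) (n * m2)) O og)
  {H : Grp} {hgen : HGen r -> H} (hH : is_presented (HRel n m1 m2 r) H hgen).

Notation W := (og OW).
Notation A i := (og (OA i)).
Notation R := (r + 1)%nat.

Lemma Oka_order : W ^ Z.of_nat (n * m2) = 1.
Proof.
  pose proof (proj1 hO _ _ (oka_ord _ _ _)) as h. now rewrite weval_wpow in h.
Qed.

Lemma Oka_per i k : A (i + Z.of_nat (R * m2) * k) = A i.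
Proof.
  assert (h : forall i, A (i + Z.of_nat (R * m2)) = A i).
  { intros j. symmetry. exact (proj1 hO _ _ (oka_per _ _ _ j)). }
  induction k using Z.peano_ind.
  - now rewrite Z.mul_0_r, Z.add_0_r.
  - now rewrite Z.mul_succ_r, Z.add_assoc, h.
  - now rewrite <- h, <- Z.add_assoc, <- Z.mul_succ_r, Z.succ_pred.
Qed.

Lemma Oka_conj i k :
  A (i + Z.of_nat (R * m1) * k) = W ^ k * A i * ginv (W ^ k).
Proof.
  assert (h : forall i, A (i + Z.of_nat (R * m1)) = W * A i * ginv W).
  { intros j. exact (proj1 hO _ _ (oka_conj _ _ _ j)). }
  induction k using Z.peano_ind.
  - rewrite Z.mul_0_r, Z.add_0_r, gpow_0. now gsimpl.
  - rewrite Z.mul_succ_r, Z.add_assoc, h, IHk, gpow_succ. now gsimpl.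
  - apply (gmul_cancel_l W), (gmul_cancel_r (ginv W)). rewrite <- h.
    rewrite <- Z.add_assoc, <- Z.mul_succ_r, Z.succ_pred, IHk, gpow_pred.
    now gsimpl.
Qed.

(** Bezout splits [R k] into [R m1 (u k)], which acts by conjugation, and [R m2 (v k)], a multiple
    of the period. *)
Lemma Oka_shift i k :
  A (i + Z.of_nat R * k) = W ^ (u * k) * A i * ginv (W ^ (u * k)).
Proof.
  rewrite <- Oka_conj.
  rewrite <- (Oka_per (i + Z.of_nat (R * m1) * (u * k)) (v * k)). f_equal. f_equal.
  replace (Z.of_nat R * k)%Z with
    (Z.of_nat R * k * (u * Z.of_nat m1 + v * Z.of_nat m2))%Z
    by (rewrite huv; ring).
  rewrite !Nat2Z.inj_mul. ring.
Qed.

(** A shift of indices by [R m1 m2] is conjugation by [W^m2] and also a multiple of the period. *)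
Lemma Oka_central : central (W ^ Z.of_nat m2).
Proof.
  apply (presented_central hO). intros [|i].
  - apply commute_sym, commute_pow. reflexivity.
  - pose proof (Oka_conj i (Z.of_nat m2)) as h.
    replace (Z.of_nat (R * m1) * Z.of_nat m2)%Z
      with (Z.of_nat (R * m2) * Z.of_nat m1)%Z in h by lia.
    rewrite Oka_per in h. unfold commute. rewrite h at 2. now gsimpl.
Qed.

Notation D := (dprod (fun i => A (Z.of_nat i)) R).

(** By [dprod_blocks], the relation for [W] reads [W = W^(u m1) (W^(-u) D)^m1], and
    [1 - u m1 = v m2]. *)
Lemma Oka_a : (ginv (W ^ u) * D) ^ Z.of_nat m1 = W ^ (v * Z.of_nat m2).
Proof.
  pose proof (proj1 hO _ _ (oka_w _ _ _)) as h. cbn [weval] in h.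
  rewrite weval_okaprod, Nat.mul_comm, (dprod_blocks _ (W ^ u)) in h.
  - apply (gmul_cancel_l ((W ^ u) ^ Z.of_nat m1)). rewrite <- h.
    rewrite gpow_mul, <- gpow_add, huv. now rewrite gpow_1.
  - intros i. rewrite Nat2Z.inj_add. pose proof (Oka_shift (Z.of_nat i) 1) as hs.
    now rewrite !Z.mul_1_r in hs.
Qed.

Notation b := (hgen HB).
Notation W' := (b ^ v').

(** The generators [x_i] indexed by naturals, with default 1 out of range, so that [dprod] applies
    to them. *)
Definition oka_x (i : nat) : H :=
  match lt_dec i r with
  | left h => hgen (HX (Fin.of_nat_lt h))
  | right _ => 1
  end.

(* The image of [a_0] is forced by [a_r ... a_1 a_0 = W^u a]. *)
Definition oka_y (i : nat) : H :=
  match i with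
  | 0%nat => ginv (dprod oka_x r) * (W' ^ u * hgen HA)
  | S i => oka_x i
  end.

(** Writing [i = R q + j] with [0 <= j < R], [Oka_shift] forces the image of [a_i] to be the
    conjugate by [W'^(u q)] of the image of [a_j]. *)
Definition oka_img (i : Z) : H :=
  W' ^ (u * (i / Z.of_nat R)) * oka_y (Z.to_nat (i mod Z.of_nat R))
    * ginv (W' ^ (u * (i / Z.of_nat R))).

Lemma oka_x_to_nat (i : Fin.t r) :
  oka_x (proj1_sig (Fin.to_nat i)) = hgen (HX i).
Proof.
  unfold oka_x. destruct (lt_dec _ r) as [h|h].
  - do 2 f_equal. rewrite <- (Fin.of_nat_to_nat_inv i) at 2. apply Fin.of_nat_ext.
  - contradict h. exact (proj2_sig (Fin.to_nat i)).
Qed.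

Lemma dprod_oka_y : dprod oka_y R = W' ^ u * hgen HA.
Proof.
  rewrite dprod_add.
  rewrite (dprod_ext _ oka_x) by (intros; now rewrite Nat.add_1_r).
  simpl. now gsimpl.
Qed.

Lemma oka_img_shift i k :
  oka_img (i + Z.of_nat R * k) = W' ^ (u * k) * oka_img i * ginv (W' ^ (u * k)).
Proof.
  unfold oka_img.
  rewrite (Z.mul_comm (Z.of_nat R)), Z.div_add, Z.mod_add by lia.
  rewrite (Z.add_comm _ k), Z.mul_add_distr_l, gpow_add. now gsimpl.
Qed.

Lemma oka_img_small (i : nat) : i < R -> oka_img (Z.of_nat i) = oka_y i.
Proof.
  intros hi. unfold oka_img.
  rewrite Z.div_small, Z.mod_small, Z.mul_0_r, gpow_0, Nat2Z.id by lia.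
  now gsimpl.
Qed.

Lemma W'_v : W' ^ v = b.
Proof.
  rewrite gpow_mul. rewrite <- (gpow_1 b) at 2.
  apply gpow_congr with (Z.of_nat (n * m2)).
  - rewrite Nat.mul_comm, Nat2Z.inj_mul, <- gpow_mul, <- (H_ab hH).
    apply (H_order hH).
  - now rewrite Z.mul_comm.
Qed.

Lemma W'_central : central (W' ^ Z.of_nat m2).
Proof.
  rewrite gpow_mul, Z.mul_comm, <- gpow_mul, <- (H_ab hH).
  apply central_pow, (H_central hH).
Qed.

Lemma W'_order : W' ^ Z.of_nat (n * m2) = 1.
Proof.
  rewrite gpow_mul, Z.mul_comm, <- gpow_mul, Nat.mul_comm, Nat2Z.inj_mul.
  rewrite <- (gpow_mul b), <- (H_ab hH), (H_order hH). apply gpow_one.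
Qed.

(** The shift conjugates by [W'^(u m1) = W' W'^(-m2 v)], and the second factor is central. *)
Lemma oka_img_conj i :
  oka_img (i + Z.of_nat (R * m1)) = W' * oka_img i * ginv W'.
Proof.
  rewrite Nat2Z.inj_mul, oka_img_shift.
  replace (u * Z.of_nat m1)%Z with (1 + Z.of_nat m2 * (- v))%Z by lia.
  rewrite gpow_add, gpow_1, <- gpow_mul. gsimpl.
  pose proof (central_pow _ (- v) W'_central (oka_img i)) as h.
  f_equal. rewrite gmulA, h. now gsimpl.
Qed.

Lemma Oka_to_H : exists g : O -> H,
  is_hom g /\ g W = W' /\ forall i, g (A i) = oka_img i.
Proof.
  destruct (presented_hom hO H
    (fun x => match x with OW => W' | OA i => oka_img i end)) as (g & hg & hgx).
  - intros p q [| |i|i].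
    + rewrite weval_okaprod, Nat.mul_comm, (dprod_blocks _ (W' ^ u)).
      * rewrite (dprod_ext _ oka_y) by (intros; now apply oka_img_small).
        (* The product is [W'^(u m1) a^m1 = W'^(u m1) b^m2]; with [b = W'^v] this is
           [W'^(u m1 + v m2) = W']. *)
        rewrite dprod_oka_y, gmulKl, (gpow_mul W'), (H_ab hH). cbn [weval].
        pose proof W'_v as hb. set (w := W') in *. clearbody w.
        now rewrite <- hb, gpow_mul, <- gpow_add, huv, gpow_1.
      * intros i. rewrite Nat2Z.inj_add.
        pose proof (oka_img_shift (Z.of_nat i) 1) as hs.
        now rewrite !Z.mul_1_r in hs.
    + rewrite weval_wpow. apply W'_order.
    (* A shift by the period [R m2] conjugates by the central element [W'^(m2 u)]. *)
    + cbn [weval]. rewrite Nat2Z.inj_mul, oka_img_shift, Z.mul_comm, <- gpow_mul.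
      rewrite (central_pow _ u W'_central). now gsimpl.
    + apply oka_img_conj.
  - exists g. split; [auto|]. split; [apply (hgx OW)|]. intros i. apply (hgx (OA i)).
Qed.

(** Elements of [Fin.t r] count from 0, so the free generators go to [a_1, ..., a_r], while [a_0]
    enters only through [D]. *)
Lemma H_to_Oka : exists f : H -> O, is_hom f /\
  (forall i, f (hgen (HX i)) = A (Z.of_nat (S (proj1_sig (Fin.to_nat i))))) /\
  f (hgen HA) = ginv (W ^ u) * D /\ f b = W ^ v.
Proof.
  destruct (H_hom hH O (fun x => match x with
    | HX i => A (Z.of_nat (S (proj1_sig (Fin.to_nat i))))
    | HA => ginv (W ^ u) * D
    | HB => W ^ v end)) as (f & hf & hfx).
  - now rewrite Oka_a, gpow_mul.
  - rewrite Oka_a, gpow_mul.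
    replace (v * Z.of_nat m2 * Z.of_nat n)%Z with (Z.of_nat (n * m2) * v)%Z by lia.
    rewrite <- gpow_mul, Oka_order. apply gpow_one.
  - intros i. rewrite Oka_a, Z.mul_comm, <- gpow_mul.
    apply central_pow, Oka_central.
  - exists f. split; [auto|]. split; [intros i; apply (hfx (HX i))|].
    split; [apply (hfx HA)|apply (hfx HB)].
Qed.

Lemma Oka_iso_of_units : Iso H O.
Proof.
  destruct Oka_to_H as (g & hg & hgW & hgA).
  destruct H_to_Oka as (f & hf & hfX & hfA & hfB).
  apply (Iso_of_inverse f g hf).
  - apply (presented_hom_eq hH (fun x => g (f x)) (fun x => x)).
    + now apply hom_comp.
    + intros x y; auto.
    + intros [i| |].
      * rewrite hfX, hgA, oka_img_small; [apply oka_x_to_nat|].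
        pose proof (proj2_sig (Fin.to_nat i)). simpl in *. lia.
      * rewrite hfA, hg, (hom_inv hg), (hom_pow hg), hgW, hom_dprod by auto.
        rewrite (dprod_ext _ oka_y), dprod_oka_y; [now gsimpl|].
        intros i hi. rewrite hgA. now apply oka_img_small.
      * now rewrite hfB, (hom_pow hg), hgW, W'_v.
  - assert (hfW : f W' = W).
    { rewrite (hom_pow hf), hfB, gpow_mul. rewrite <- (gpow_1 W) at 2.
      apply gpow_congr with (Z.of_nat (n * m2)); [apply Oka_order|auto]. }
    assert (hfWk : forall k, f (W' ^ k) = W ^ k)
      by (intros k; now rewrite (hom_pow hf), hfW).
    assert (hfx : forall i, i < r -> f (oka_x i) = A (Z.of_nat (S i))).
    { intros i hi. unfold oka_x. destruct (lt_dec i r) as [h|h]; [|lia].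
      now rewrite hfX, Fin.to_nat_of_nat. }
    assert (hfy : forall i, i < R -> f (oka_y i) = A (Z.of_nat i)).
    { intros [|i] hi; [|apply hfx; lia]. cbn [oka_y].
      (* The image of [oka_y 0] is [(a_r ... a_1)^-1 D]; splitting off the last factor of [D] leaves
         [a_0]. *)
      rewrite !hf, (hom_inv hf), hfWk, hfA, gmulKr.
      rewrite dprod_add, hom_dprod by auto.
      rewrite (dprod_ext (fun i => f (oka_x i)) (fun i => A (Z.of_nat (i + 1)))).
      - simpl. now gsimpl.
      - intros i hi'. rewrite hfx by auto. do 3 f_equal. lia. }
    apply (presented_hom_eq hO (fun x => f (g x)) (fun x => x)).
    + now apply hom_comp.
    + intros x y; auto.
    + intros [|i]; [now rewrite hgW|]. rewrite hgA. unfold oka_img.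
      (* The residue index is below [R], and conjugating by [W^(u (i / R))] shifts it back to
         [i]. *)
      pose proof (Z.mod_pos_bound i (Z.of_nat R)).
      rewrite !hf, (hom_inv hf), hfWk, hfy by lia.
      rewrite Z2Nat.id by lia. rewrite <- Oka_shift. do 2 f_equal.
      rewrite Z.add_comm. symmetry. apply Z.div_mod. lia.
Qed.

End Oka.

(** Bezout pairs may be changed to [u - k m2, v + k m1]. As [v] is prime to [m1], [unit_lift] gives
    a [k] making [v + k m1] prime to [n m2]. *)
Lemma Oka_iso (n m1 m2 r : nat) (hn : 0 < n) (hm2 : 0 < m2)
    (hcop : rel_prime (Z.of_nat m1) (Z.of_nat m2))
    (H : Grp) (hgen : HGen r -> H) (O : Grp) (og : OkaGen -> O) :
  is_presented (HRel n m1 m2 r) H hgen ->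
  is_presented (OkaRel ((r + 1) * m1) ((r + 1) * m2) (n * m2)) O og ->
  Iso H O.
Proof.
  intros hH hO. destruct (rel_prime_bezout _ _ hcop) as [u v huv].
  destruct (unit_lift v (Z.of_nat m1) (Z.of_nat (n * m2))) as [k hk]; [nia| |].
  - intros d [a ha] [b hb] _. exists (u * b + a * Z.of_nat m2)%Z.
    rewrite <- huv, ha, hb. ring.
  - destruct (rel_prime_inverse _ _ hk) as [v' hv'].
    refine (Oka_iso_of_units (u := u - k * Z.of_nat m2) _ hv' hO hH).
    rewrite <- huv. ring.
Qed.

Close Scope grp_scope.

Theorem mainTheorem6 (n m1 m2 r : nat)
  (hn : 0 < n) (hm1 : 0 < m1) (hm2 : 0 < m2) (hcop : Nat.gcd m1 m2 = 1)
  (H : Grp) (hgen : HGen r -> H) (hpres : is_presented (HRel n m1 m2 r) H hgen) :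
  HCond n m1 m2 r H /\
  (forall G : Grp, HCond n m1 m2 r G -> Iso G H) /\
  (forall (O : Grp) (og : OkaGen -> O),
     is_presented (OkaRel ((r + 1) * m1) ((r + 1) * m2) (n * m2)) O og ->
     Iso H O) /\
  (Nat.gcd n (m1 * m2) = 1 ->
   forall (C : Grp) (cg : unit -> C) (F : Grp) (fg : HGen r -> F),
     is_presented (CycRel n) C cg -> is_presented (FPRel m1 m2 r) F fg ->
     Iso H (prodGrp C F)).
Proof.
  apply nat_gcd_rel_prime in hcop.
  split; [split; [exact (H_central_ext hn hm1 hm2 hpres)
                 |exact (H_abelianization hn hm1 hm2 hcop hpres)]|].
  split; [|split].
  - exact (H_unique hn hm1 hm2 hcop hpres).
  - intros O og. now apply (Oka_iso n m1 m2 r hn hm2 hcop H hgen).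
  - intros hnm C cg F fg. apply nat_gcd_rel_prime in hnm.
    rewrite Nat2Z.inj_mul in hnm. now apply (H_product hpres).
Qed.
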